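(* Let $$\mathfrak{W}^-_{\mathbb{Q},0}(n)=\Big\{\sum_{q<0}a_q\chi_q:\ a_q\in M_n(\mathbb{C}),\ \sum_{q<0}\|a_q\|<\infty\Big\}\subset M_n(\mathfrak{W}_{\mathbb{Q}})$$ be the strictly negative matrix Wiener algebra. There exists $\varepsilon_n>0$ such that every $g\in\boldsymbol\Lambda_W(n)$ satisfying $\|g-I\|_{\mathfrak{W}_{\mathbb{Q}}}<\varepsilon_n$ admits a unique normalized factorization $$g=h_-^{-1}h_+,\qquad h_-\in I+\mathfrak{W}^-_{\mathbb{Q},0}(n),\qquad h_+\in\mathrm{GL}_n(\mathfrak{W}^+_{\mathbb{Q}}).$$ The factors depend analytically on $g$ in a neighbourhood of the identity.
   Context: The universal solenoid is $S^1_{\mathbb{Q}}=\varprojlim S^1$ over positive integers ordered by divisibility, with bonding maps $z\mapsto z^{m/n}$ for $n\mid m$; it is a compact connected abelian group with Pontryagin dual the discrete group $\mathbb{Q}$. For $q=k/N\in\mathbb{Q}$ the corresponding character is $\chi_q(\mathbf{u})=\pi_N(\mathbf{u})^k$, where $\pi_N:S^1_{\mathbb{Q}}\to S^1$ is the projection to level $N$. The rational Wiener algebra $\mathfrak{W}_{\mathbb{Q}}$ consists of the functions $\sum_{q\in\mathbb{Q}}a_q\chi_q$ on $S^1_{\mathbb{Q}}$ with $a_q\in\mathbb{C}$, $\sum|a_q|<\infty$. The algebra $M_n(\mathfrak{W}_{\mathbb{Q}})=\mathfrak{W}_{\mathbb{Q}}(n)$ is a Banach algebra with norm $\|f\|_{\mathfrak{W}_{\mathbb{Q}}}=\sum_{q}\|A_q\|$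 for $f=\sum_qA_q\chi_q$, $A_q\in M_n(\mathbb{C})$, where $\|\cdot\|$ on $M_n(\mathbb{C})$ is a fixed submultiplicative norm. $\mathfrak{W}^+_{\mathbb{Q}}$ is the closed subalgebra of elements of $\mathfrak{W}_{\mathbb{Q}}$ with $a_q=0$ for all $q<0$ (the constant term is allowed), and $\mathrm{GL}_n(\mathfrak{W}^+_{\mathbb{Q}})$ is the group of units of $M_n(\mathfrak{W}^+_{\mathbb{Q}})$. $\boldsymbol\Lambda_W(n)=\mathrm{GL}_n(\mathfrak{W}_{\mathbb{Q}})$ is the group of units of $M_n(\mathfrak{W}_{\mathbb{Q}})$. In the factorization $h_-$ is invertible in $M_n(\mathfrak{W}_{\mathbb{Q}})$. *)

(* Defs.v *)
From HB Require Import structures.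
From mathcomp Require Import all_boot all_order all_algebra.
From mathcomp Require Import complex.
From mathcomp Require Import all_classical all_reals all_analysis.
From mathcomp Require summability.
Set Implicit Arguments.
Unset Strict Implicit.
Unset Printing Implicit Defensive.
Import Order.TTheory GRing.Theory Num.Theory.
Import numFieldNormedType.Exports.
Local Open Scope classical_set_scope.
Local Open Scope ring_scope.
Local Open Scope complex_scope.

(* A thread (z_N)_{N > 0} of the inverse limit of the circles along divisibility.
   Level 0 is not part of the inverse system; it is pinned to 1 so that a point
   is determined by its coordinates at the positive levels. *)
Record solenoid (R : realType) := Solenoid {
  sol_proj : nat -> R[i];
  sol_proj0 : sol_proj 0 = 1;
  sol_circle : forall N, (0 < N)%N -> Normc.normc (sol_proj N) = 1;
  sol_bond : forall m N, (0 < m)%N -> (N %| m)%N ->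
    sol_proj m ^+ (m %/ N) = sol_proj N }.

Definition chi (R : realType) (q : rat) (u : solenoid R) : R[i] :=
  sol_proj u `|denq q|%N ^ numq q.

(* The choice of the fraction k / N representing q is irrelevant. *)
Lemma chi_fracE (R : realType) (k : int) (N : nat) (u : solenoid R) :
  (0 < N)%N -> chi (k%:~R / N%:R) u = sol_proj u N ^ k.
Proof.
move=> N0; set q : rat := _ / _.
have Nq : (N%:R : rat) != 0 by rewrite pnatr_eq0 -lt0n.
have e : k * denq q = numq q * N%:Z.
  apply/eqP; rewrite -(eqr_int rat) !intrM.
  have dq : (denq q)%:~R != 0 :> rat by rewrite intr_eq0 denq_eq0.
  have := divq_num_den q; rewrite {3}/q => /eqP.
  by rewrite eqr_div // => /eqP <-; rewrite pmulrn.
have dN : (`|denq q| %| N)%N.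
  have : (`|denq q| %| `|numq q| * N)%N.
    by rewrite -[X in (_ * X)%N]/(`|N%:Z|)%N -abszM -e abszM dvdn_mull.
  by rewrite Gauss_dvdr // coprime_sym coprime_num_den.
have d0 : (0 < `|denq q|)%N by rewrite absz_gt0 denq_eq0.
rewrite /chi -(sol_bond u N0 dN) -[_ ^+ _]/(_ ^ (Posz _)) exprz_exp; congr (_ ^ _).
apply: (@mulIf _ (denq q)); first by rewrite denq_eq0.
by rewrite e mulrAC -[X in _ * X * _](absz_denq q) -PoszM divnK // mulrC.
Qed.

Section WienerAlgebra.
Variables (R : realType) (n : nat).
Local Notation C := R[i].
Local Notation mfun := (solenoid R -> 'M[C]_n).

(* f = \sum_q a_q chi_q with \sum_q |a_q| < +oo; the sum is the limit of the
   net of finite partial sums. *)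
Definition wiener_expansion (a : rat -> C) (f : solenoid R -> C) : Prop :=
  (\esum_(q in setT) (Normc.normc (a q))%:E < +oo)%E /\
  forall u, summability.partial_sum (fun q => a q * chi q u : C^o)
              @ summability.totally --> (f u : C^o).

Definition wiener : set (solenoid R -> C) :=
  [set f | exists a, wiener_expansion a f].

(* The coefficient family of f is unique when it exists; it is 0 by default. *)
Definition wcoef (f : solenoid R -> C) : rat -> C :=
  xget 0 [set a | wiener_expansion a f].

Definition wiener_plus : set (solenoid R -> C) :=
  [set f | wiener f /\ forall q, q < 0 -> wcoef f q = 0].

Definition entry (f : mfun) (i j : 'I_n) : solenoid R -> C := fun u => f u i j.

Definition mx_over (W : set (solenoid R -> C)) : set mfun :=
  [set f | forall i j, W (entry f i j)].

Definition mx_wcoef (f : mfun) (q : rat) : 'M[C]_n :=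
  \matrix_(i, j) wcoef (entry f i j) q.

Definition submult_norm (nu : 'M[C]_n -> R) : Prop :=
  [/\ forall A, nu A = 0 -> A = 0,
      forall A B, nu (A + B) <= nu A + nu B,
      forall (c : C) A, nu (c *: A) = Normc.normc c * nu A &
      forall A B, nu (A *m B) <= nu A * nu B].

(* The sum is finite for f in mx_over wiener, the only case of interest. *)
Definition wnorm (nu : 'M[C]_n -> R) (f : mfun) : R :=
  fine (\esum_(q in setT) (nu (mx_wcoef f q))%:E).

Definition wiener_minus0 (nu : 'M[C]_n -> R) : set mfun :=
  [set f : mfun | exists a : rat -> 'M[C]_n,
     [/\ forall q, 0 <= q -> a q = 0,
         (\esum_(q in [set q : rat | (q < 0)%R]) (nu (a q))%:E < +oo)%E &
         forall u i j,
           summability.partial_sum (fun q => a q i j * chi q u : C^o)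
             @ summability.totally --> (f u i j : C^o)]].

End WienerAlgebra.

Definition units_of (A : pzRingType) (S : set A) : set A :=
  [set x | S x /\ exists2 y, S y & x * y = 1 /\ y * x = 1].

Definition LambdaW (R : realType) (n : nat) : set (solenoid R -> 'M[R[i]]_n) :=
  units_of (mx_over (@wiener R)).

Definition GLWplus (R : realType) (n : nat) : set (solenoid R -> 'M[R[i]]_n) :=
  units_of (mx_over (@wiener_plus R)).

(* In the last clause the inverse of h_- is taken pointwise, which is its inverse
   in the algebra of matrix-valued functions. *)
Definition normalized_factorization (R : realType) (n : nat)
    (nu : 'M[R[i]]_n -> R) (g hm hp : solenoid R -> 'M[R[i]]_n) : Prop :=
  [/\ wiener_minus0 nu (hm - 1), LambdaW hm, GLWplus hp &
      g = fun u => invmx (hm u) *m hp u].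

Section Analytic.
Variables (R : realType) (V : lmodType R[i]) (E : set V) (N : V -> R).

Definition multilinear_on (k : nat) (P : ('I_k -> V) -> V) : Prop :=
  forall (i : 'I_k) (v : 'I_k -> V) (c : R[i]) (x y : V),
    (forall j, E (v j)) -> E x -> E y ->
    P [eta v with i |-> c *: x + y] =
      c *: P [eta v with i |-> x] + P [eta v with i |-> y].

(* Complex analyticity at a of a self-map of the normed space (E, N), E being a
   linear subspace of V: near a, f is the sum of a power series
   \sum_k P_k(h, ..., h) of bounded multilinear maps, normally convergent on a
   ball of positive radius. *)
Definition analytic_at (f : V -> V) (a : V) : Prop :=
  exists (r : R) (c : nat -> R) (P : forall k, ('I_k -> V) -> V),
    [/\ 0 < r,
        (forall k, 0 <= c k) /\ cvgn (series (fun k => c k * r ^+ k)),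
        forall k, multilinear_on (P k),
        forall k v, (forall i, E (v i)) ->
          E (P k v) /\ N (P k v) <= c k * \prod_(i < k) N (v i) &
        forall h, E h -> N h < r ->
          E (f (a + h)) /\
          N (f (a + h) - \sum_(k < m) P k (fun=> h)) @[m --> \oo] --> 0].

End Analytic.

(* Main.v *)
Require Import Defs.
From HB Require Import structures.
From mathcomp Require Import all_boot all_order all_algebra.
From mathcomp Require Import complex finmap.
From mathcomp Require Import all_classical all_reals all_analysis.
From mathcomp Require summability.
From mathcomp Require Import ring lra.
Set Implicit Arguments.
Unset Strict Implicit.
Unset Printing Implicit Defensive.
Import Order.TTheory GRing.Theory Num.Theory.
Import numFieldNormedType.Exports.
Local Open Scope classical_set_scope.
Local Open Scope ring_scope.
Local Open Scope complex_scope.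

(** Through its Fourier coefficients the algebra becomes l^1(Q; M_n(C)) under
    convolution, and dropping the nonnegative or the negative frequencies gives
    two projections P- and P+ of norm at most 1. Put w = g - 1. If h_- = 1 + x
    with x strictly negative and h_- g = h_+ has no negative frequency, then
    applying P- shows that z = h_- solves the linear equation
<<
        z + P-(z w) = 1,
>>
    and conversely a solution z has z - 1 strictly negative and
    z g = 1 + P+(z w). As z |-> P-(z w) has norm at most |w| < 1, the equation
    has exactly one solution, given by a Neumann series. This yields the
    factors and their uniqueness at once.

    Invertibility comes from smallness. If |w| < 1/2, then |z w| < 1
    ([minus_factorM_lt1]), so both factors lie at distance less than 1 from 1.
    For h_+ the inverse has to stay in the algebra of nonnegative frequencies;
    it is found by solving an equation truncated by P+ ([Wplus_unit]).

    For analyticity at an arbitrary base point w0, let S be the inverse of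
    z |-> z + P-(z w0). The solution for w0 + h is the sum over k of the terms
    (- S B_h)^k S 1 with B_h z = P-(z h), which are k-linear in h and decay
    geometrically ([resolvent_analytic]). Both factors are 1 plus a bounded
    bilinear function of w and of the solution, so this one expansion covers
    them.

    Two facts about the solenoid are used. The coefficients of a function are
    unique, because a nonzero absolutely convergent sum of characters does not
    vanish on the winding line ([expansion0]). And l^1(Q; M_n(C)) is a
    complete normed algebra for any submultiplicative norm ([synthM],
    [wiener_mx_complete]); this rests on unconditional sums of complex and
    matrix families, whose exchange is reduced to the nonnegative case. *)

Local Notation normc := Normc.normc.
#[local] Existing Instance summability.totally_filter.

(** * Sums of nonnegative and real families *)

Section FinitePartialSums.
Variables (T : choiceType).

Lemma partial_sumE (V : zmodType) (f : T -> V) (F : {fset T}) :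
  summability.partial_sum f F = \sum_(x <- F) f x.
Proof. by rewrite /summability.partial_sum [RHS]big_seq_fsetE. Qed.

Lemma near_totally (F0 : {fset T}) (P : {fset T} -> Prop) :
  (forall F, (F0 `<=` F)%fset -> P F) -> \forall F \near summability.totally, P F.
Proof. by move=> h; exists F0. Qed.

End FinitePartialSums.

Section NonnegativeSums.
Variables (R : realType) (T : choiceType).
Implicit Types f g : T -> R.

Definition nnsum f : R := fine (\esum_(x in setT) (f x)%:E)%E.

Definition nnsummable f : Prop :=
  (forall x, 0 <= f x) /\ (\esum_(x in setT) (f x)%:E < +oo)%E.

Lemma nnsumE f : nnsummable f -> (nnsum f)%:E = (\esum_(x in setT) (f x)%:E)%E.
Proof.
case=> f0 fs; rewrite /nnsum fineK// fin_numElt fs andbT.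
by rewrite (lt_le_trans (ltNyr 0))//; apply: esum_ge0 => x _; rewrite lee_fin.
Qed.

Lemma fsum_le_nnsum f (F : {fset T}) : nnsummable f ->
  \sum_(x <- F) f x <= nnsum f.
Proof.
move=> fs; rewrite -lee_fin nnsumE// -sumEFin; apply: esum_ge.
exists [set` F] => //; rewrite fsbig_finite//= set_fsetK //.
Qed.

Lemma nnsum_le f (M : R) : (forall x, 0 <= f x) ->
  (forall F : {fset T}, \sum_(x <- F) f x <= M) -> nnsummable f /\ nnsum f <= M.
Proof.
move=> f0 fM.
have h : (\esum_(x in setT) (f x)%:E <= M%:E)%E.
  apply: ge_ereal_sup => _ [X [finX _] <-].
  by rewrite fsbig_finite//= sumEFin lee_fin.
have fs : nnsummable f by split => //; apply: le_lt_trans h _; rewrite ltry.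
by split=> //; rewrite -lee_fin nnsumE.
Qed.

Lemma nnsum_ge0 f : nnsummable f -> 0 <= nnsum f.
Proof. by move=> fs; have := fsum_le_nnsum fset0 fs; rewrite big_seq_fset0. Qed.

Lemma nnsummable_ge0 f x : nnsummable f -> 0 <= f x.
Proof. by case. Qed.

Lemma nnsummable_le f g : (forall x, 0 <= f x <= g x) -> nnsummable g ->
  nnsummable f /\ nnsum f <= nnsum g.
Proof.
move=> fg gs; apply: nnsum_le => [x|F]; first by case/andP: (fg x).
apply: le_trans (fsum_le_nnsum F gs); apply: ler_sum => x _.
by case/andP: (fg x).
Qed.

Lemma le_nnsum1 f x : nnsummable f -> f x <= nnsum f.
Proof. by move=> fs; have := fsum_le_nnsum [fset x]%fset fs; rewrite big_seq_fset1. Qed.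

Lemma nnsum_approx f (e : R) : nnsummable f -> 0 < e ->
  \forall F \near summability.totally, nnsum f - e < \sum_(x <- (F : {fset T})) f x.
Proof.
move=> fs e0.
have : ((nnsum f - e)%:E < \esum_(x in setT) (f x)%:E)%E.
  by rewrite -nnsumE// lte_fin ltrBlDr ltrDl.
move=> /ereal_sup_gt[_ [X [finX _] <-]].
rewrite fsbig_finite//= sumEFin lte_fin => h.
apply: (@near_totally _ (fset_set X)) => F XF; apply: lt_le_trans h _.
rewrite [leRHS](big_fsetID _ (fun x => x \in fset_set X))/=.
rewrite (_ : [fset x in F | x \in fset_set X]%fset = fset_set X); last first.
  by apply/fsetP => x; rewrite !inE/= andbC; case: (boolP (x \in fset_set X)) => // /(fsubsetP XF).
by rewrite lerDl sumr_ge0// => x _; apply: nnsummable_ge0.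
Qed.

Lemma nnsum_cvg f : nnsummable f ->
  summability.partial_sum f @ summability.totally --> nnsum f.
Proof.
move=> fs; apply/cvgrPdist_lt => e e0.
apply: filterS (nnsum_approx fs e0) => F h.
rewrite partial_sumE ger0_norm ?subr_ge0 ?fsum_le_nnsum//.
by rewrite ltrBlDr addrC -ltrBlDr.
Qed.

Lemma nnsum_eq f g : f =1 g -> nnsum f = nnsum g.
Proof. by move=> /funext->. Qed.

Lemma nnsumD f g : nnsummable f -> nnsummable g ->
  nnsummable (fun x => f x + g x) /\
  nnsum (fun x => f x + g x) = nnsum f + nnsum g.
Proof.
move=> fs gs.
have e : (\esum_(x in setT) (f x + g x)%:E = (nnsum f + nnsum g)%:E)%E.
  rewrite EFinD !nnsumE// -esumD//; first by move=> x _; rewrite lee_fin (nnsummable_ge0 x fs).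
  by move=> x _; rewrite lee_fin (nnsummable_ge0 x gs).
split; last by rewrite /nnsum e.
split; last by rewrite e ltry.
by move=> x; rewrite addr_ge0// ?(nnsummable_ge0 x fs) ?(nnsummable_ge0 x gs).
Qed.

Lemma nnsumZ (c : R) f : 0 <= c -> nnsummable f ->
  nnsummable (fun x => c * f x) /\ nnsum (fun x => c * f x) = c * nnsum f.
Proof.
move=> c0 fs.
have [cs _] : nnsummable (fun x => c * f x) /\ nnsum (fun x => c * f x) <= c * nnsum f.
  apply: nnsum_le => [x|F]; first by rewrite mulr_ge0// (nnsummable_ge0 x fs).
  by rewrite -mulr_sumr ler_wpM2l// fsum_le_nnsum.
split=> //.
apply: (cvg_unique (@norm_hausdorff _ R^o) (nnsum_cvg cs)).
rewrite (_ : summability.partial_sum _ = (fun F => c * summability.partial_sum f F)); last first.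
  by apply/funext => F; rewrite !partial_sumE mulr_sumr.
by apply: cvgMr; exact: nnsum_cvg.
Qed.

Lemma nnsum0 : nnsummable (fun _ : T => 0 : R) /\ nnsum (fun _ : T => 0 : R) = 0.
Proof.
have [s h] : nnsummable (fun _ : T => 0 : R) /\ nnsum (fun _ : T => 0 : R) <= 0.
  by apply: nnsum_le => // F; rewrite big1.
by split=> //; apply/eqP; rewrite eq_le h nnsum_ge0.
Qed.

Lemma nnsum_sum (I : Type) (r : seq I) (F : I -> T -> R) :
  (forall i, nnsummable (F i)) ->
  nnsummable (fun x => \sum_(i <- r) F i x) /\
  nnsum (fun x => \sum_(i <- r) F i x) = \sum_(i <- r) nnsum (F i).
Proof.
move=> Fs; elim: r => [|i r [IHs IHe]].
  under eq_fun do rewrite big_nil.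
  by rewrite big_nil; exact: nnsum0.
under eq_fun do rewrite big_cons.
by rewrite big_cons -IHe; exact: nnsumD.
Qed.

End NonnegativeSums.

Section NonnegativeExchange.
Variables (R : realType).

Lemma nnsum_reindex (T T' : choiceType) (e : T -> T') (f : T' -> R) :
  bijective e -> nnsum (fun x => f (e x)) = nnsum f /\
  (nnsummable f -> nnsummable (fun x => f (e x))).
Proof.
move=> be.
have h : (\esum_(x in setT) (f (e x))%:E = \esum_(y in setT) (f y)%:E)%E.
  rewrite (reindex_esum setT setT e)// setTT_bijective//.
by split; [rewrite /nnsum h|case=> f0 fs; split=> // ; rewrite h].
Qed.

(** Tonelli; the finiteness of one iterated sum gives that of the other. *)
Lemma nnsum_exchange (T1 T2 : choiceType) (f : T1 -> T2 -> R) :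
  (forall x, nnsummable (f x)) -> nnsummable (fun x => nnsum (f x)) ->
  [/\ forall y, nnsummable (fun x => f x y),
      nnsummable (fun y => nnsum (fun x => f x y)) &
      nnsum (fun y => nnsum (fun x => f x y)) = nnsum (fun x => nnsum (f x))].
Proof.
move=> fs fss.
have f0 x y : 0 <= f x y by apply: nnsummable_ge0.
have ex : (\esum_(x in setT) \esum_(y in setT) (f x y)%:E =
   \esum_(y in setT) \esum_(x in setT) (f x y)%:E)%E.
  rewrite !esum_esum => [| | ]; do 1? by move=> *; rewrite lee_fin.
  rewrite (reindex_esum ([set: T2] `*`` fun=> [set: T1]) _ (fun k => (k.2, k.1)))//.
  split => //= [[a b] [c d] _ _ /= [-> ->]//|[a b] _ /=]; by exists (b, a).
have e1 : (\esum_(x in setT) \esum_(y in setT) (f x y)%:E =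
   \esum_(x in setT) (nnsum (f x))%:E)%E by apply: eq_esum => x _; rewrite nnsumE.
have ys y : nnsummable (fun x => f x y).
  have [] // := @nnsummable_le _ _ (fun x => f x y) (fun x => nnsum (f x)) _ fss.
  by move=> x; rewrite f0 le_nnsum1.
have e2 : (\esum_(y in setT) \esum_(x in setT) (f x y)%:E =
   \esum_(y in setT) (nnsum (fun x => f x y))%:E)%E by apply: eq_esum => x _; rewrite nnsumE.
split=> //; last by rewrite /(nnsum (fun y => _)) -e2 -ex e1.
split; first by move=> y; apply: nnsum_ge0.
by rewrite -e2 -ex e1; case: fss.
Qed.

End NonnegativeExchange.

Section RealSums.
Variables (R : realType) (T : choiceType).
Implicit Types f g : T -> R.

(** Written with [|f| + f] and [|f|] instead of the positive and negative
    parts: both are nonnegative, and no case analysis on signs arises. *)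
Definition rsum f : R := nnsum (fun x => `|f x| + f x) - nnsum (fun x => `|f x|).

Lemma rsummable_shift f : nnsummable (fun x => `|f x|) ->
  nnsummable (fun x => `|f x| + f x).
Proof.
move=> fs; have [fs2 _] := nnsumD fs fs.
have [] // := @nnsummable_le _ _ (fun x => `|f x| + f x) _ _ fs2.
move=> x; rewrite lerD2l ler_norm andbT -lerBlDl sub0r lerNl.
by rewrite -normrN ler_norm.
Qed.

Lemma rsum_cvg f : nnsummable (fun x => `|f x|) ->
  summability.partial_sum f @ summability.totally --> rsum f.
Proof.
move=> fs.
rewrite (_ : summability.partial_sum f =
   (fun F => summability.partial_sum (fun x => `|f x| + f x) F -
             summability.partial_sum (fun x => `|f x|) F)); last first.
  by apply/funext => F; rewrite !partial_sumE -sumrB; apply: eq_bigr => x _; rewrite addrAC subrr add0r.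
by apply: cvgB; apply: nnsum_cvg => //; exact: rsummable_shift.
Qed.

(** Any splitting of [f] as a difference of nonnegative families computes the
    sum; this is how sums of sums are rewritten below. *)
Lemma rsumE f g h : nnsummable g -> nnsummable h ->
  (forall x, f x = g x - h x) -> 
  nnsummable (fun x => `|f x|) /\ rsum f = nnsum g - nnsum h.
Proof.
move=> gs hs e; have [ghs _] := nnsumD gs hs.
have [fs _] : nnsummable (fun x => `|f x|) /\ nnsum (fun x => `|f x|) <= nnsum (fun x => g x + h x).
  apply: nnsummable_le => // x; rewrite normr_ge0 e (le_trans (ler_normB _ _))//.
  by rewrite !ger0_norm ?(nnsummable_ge0 _ gs) ?(nnsummable_ge0 _ hs).
split=> //; apply: (cvg_unique (@norm_hausdorff _ R^o) (rsum_cvg fs)).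
rewrite (_ : summability.partial_sum f =
   (fun F => summability.partial_sum g F - summability.partial_sum h F)); last first.
  by apply/funext => F; rewrite !partial_sumE -sumrB; apply: eq_bigr => x _; rewrite e.
by apply: cvgB; apply: nnsum_cvg.
Qed.

End RealSums.

Lemma rsum_exchange (R : realType) (T1 T2 : choiceType) (f : T1 -> T2 -> R) :
  (forall x, nnsummable (fun y => `|f x y|)) ->
  nnsummable (fun x => nnsum (fun y => `|f x y|)) ->
  rsum (fun x => rsum (f x)) = rsum (fun y => rsum (f^~ y)).
Proof.
move=> fs fss.
have [ys yss ye] := nnsum_exchange fs fss.
have gs x : nnsummable (fun y => `|f x y| + f x y) by exact: rsummable_shift.
have gss : nnsummable (fun x => nnsum (fun y => `|f x y| + f x y)).
  have [] // := @nnsummable_le _ _ (fun x => nnsum (fun y => `|f x y| + f x y)) _ _ (nnsumD fss fss).1.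
  move=> x; rewrite nnsum_ge0//=.
  rewrite -(nnsumD (fs x) (fs x)).2; apply: (nnsummable_le _ (nnsumD (fs x) (fs x)).1).2 => y.
  by rewrite (nnsummable_ge0 _ (gs x)) lerD2l ler_norm.
have [gys gyss gye] := nnsum_exchange gs gss.
have [_ ->] := rsumE gss fss (fun x => erefl _ : rsum (f x) = _).
have [_ ->] := rsumE gyss yss (fun x => erefl _ : rsum (f^~ x) = _).
by rewrite ye gye.
Qed.

(** * Absolutely summable complex families *)

Section ComplexModulus.
Variable R : realType.
Implicit Types x y : R[i].

Lemma normr_normc x : `|x| = (normc x)%:C.
Proof. by rewrite normc_def; case: x. Qed.

Lemma normc_ge0 x : 0 <= normc x.
Proof. by case: x => a b; exact: sqrtr_ge0. Qed.

Lemma ler_normcD x y : normc (x + y) <= normc x + normc y.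
Proof. exact: le_normcD. Qed.

Lemma normcNE x : normc (- x) = normc x.
Proof. exact: normcN. Qed.

Lemma Re_le_normc x : `|complex.Re x| <= normc x.
Proof. by rewrite -lecR -normr_normc normc_ge_Re. Qed.

Lemma Im_le_normc x : `|complex.Im x| <= normc x.
Proof.
case: x => a b /=; rewrite -sqrtr_sqr ler_wsqrtr// lerDr sqr_ge0//.
Qed.

Lemma normc_le_ReIm x : normc x <= `|complex.Re x| + `|complex.Im x|.
Proof.
case: x => a b /=; rewrite -[leRHS]ger0_norm ?addr_ge0// -sqrtr_sqr ler_wsqrtr//.
rewrite sqrrD !real_normK ?num_real// lerD2r lerDl mulrn_wge0 // mulr_ge0//.
Qed.

Lemma ReD x y : complex.Re (x + y) = complex.Re x + complex.Re y.
Proof. by case: x y => [a b] [c d]. Qed.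

Lemma ImD x y : complex.Im (x + y) = complex.Im x + complex.Im y.
Proof. by case: x y => [a b] [c d]. Qed.

Lemma Re_sum (I : Type) (r : seq I) (F : I -> R[i]) :
  complex.Re (\sum_(i <- r) F i) = \sum_(i <- r) complex.Re (F i).
Proof. by apply: (big_morph _ ReD). Qed.

Lemma Im_sum (I : Type) (r : seq I) (F : I -> R[i]) :
  complex.Im (\sum_(i <- r) F i) = \sum_(i <- r) complex.Im (F i).
Proof. by apply: (big_morph _ ImD). Qed.

Lemma ler_normc_sum (I : Type) (r : seq I) (F : I -> R[i]) :
  normc (\sum_(i <- r) F i) <= \sum_(i <- r) normc (F i).
Proof.
elim: r => [|i r IH]; first by rewrite !big_nil Normc.normc0.
by rewrite !big_cons (le_trans (ler_normcD _ _))// lerD2l.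
Qed.

End ComplexModulus.

Section ComplexSums.
Variables (R : realType) (T : choiceType).
Local Notation C := R[i].
Implicit Types f g : T -> C.

Definition csummable f := nnsummable (fun x => normc (f x)).

(** The parts are summed separately because the existence of the sum comes from
    the order of the reals. *)
Definition csum f : C :=
  rsum (fun x => complex.Re (f x)) +i* rsum (fun x => complex.Im (f x)).

Definition has_csum f (l : C) :=
  summability.partial_sum (f : T -> C^o) @ summability.totally --> (l : C^o).

Lemma has_csumP f l : has_csum f l <-> forall e : R, 0 < e ->
  \forall F \near summability.totally, normc (l - \sum_(x <- (F : {fset T})) f x) < e.
Proof.
rewrite /has_csum; split=> [/cvgrPdist_lt h e e0|h].
  have e0' : 0 < e%:C by rewrite ltcR.
  apply: filterS (h _ e0') => F.
  by rewrite partial_sumE normr_normc ltcR.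
apply/cvgrPdist_lt => e e0.
have e0' : 0 < complex.Re e by move: e0; rewrite ltcE => /andP[].
have ee : e = (complex.Re e)%:C.
  by move: e0; case: (e) => a b; rewrite ltcE /= => /andP[/eqP->].
apply: filterS (h _ e0') => F.
by rewrite partial_sumE normr_normc [in X in _ -> X]ee ltcR.
Qed.

Lemma csummableRe f : csummable f -> nnsummable (fun x => `|complex.Re (f x)|).
Proof.
move=> fs; have [] // := @nnsummable_le _ _ (fun x => `|complex.Re (f x)|) _ _ fs.
by move=> x; rewrite normr_ge0 Re_le_normc.
Qed.

Lemma csummableIm f : csummable f -> nnsummable (fun x => `|complex.Im (f x)|).
Proof.
move=> fs; have [] // := @nnsummable_le _ _ (fun x => `|complex.Im (f x)|) _ _ fs.
by move=> x; rewrite normr_ge0 Im_le_normc.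
Qed.

Lemma csum_cvg f : csummable f -> has_csum f (csum f).
Proof.
move=> fs; apply/has_csumP => e e0.
have e2 : 0 < e / 2 by rewrite divr_gt0.
have /cvgrPdist_lt/(_ _ e2) hR := rsum_cvg (csummableRe fs).
have /cvgrPdist_lt/(_ _ e2) hI := rsum_cvg (csummableIm fs).
apply: filterS2 hR hI => F; rewrite !partial_sumE => hR hI.
rewrite (le_lt_trans (normc_le_ReIm _))// [ltRHS](splitr e).
have -> z w : complex.Re (z - w) = complex.Re z - complex.Re w :> R by case: z w => [a b] [c d].
have -> z w : complex.Im (z - w) = complex.Im z - complex.Im w :> R by case: z w => [a b] [c d].
by rewrite Re_sum Im_sum ltrD.
Qed.

Lemma has_csum_unique f l l' : has_csum f l -> has_csum f l' -> l = l'.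
Proof. exact: (cvg_unique (@norm_hausdorff _ C^o)). Qed.

Lemma csumE f l : csummable f -> has_csum f l -> csum f = l.
Proof. by move=> /csum_cvg; exact: has_csum_unique. Qed.

Lemma csum_ext f g : f =1 g -> csum f = csum g.
Proof. by move=> /funext->. Qed.

Lemma csummableD f g : csummable f -> csummable g -> csummable (fun x => f x + g x).
Proof.
move=> fs gs; have [] // := @nnsummable_le _ _ (fun x => normc (f x + g x)) _ _ (nnsumD fs gs).1.
by move=> x; rewrite normc_ge0 ler_normcD.
Qed.

Lemma csumD f g : csummable f -> csummable g ->
  csum (fun x => f x + g x) = csum f + csum g.
Proof.
move=> fs gs; apply: csumE; first exact: csummableD.
rewrite /has_csum (_ : summability.partial_sum _ =
   (fun F => summability.partial_sum (f : T -> C^o) F + summability.partial_sum (g : T -> C^o) F)); last first.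
  by apply/funext => F; rewrite !partial_sumE big_split.
by apply: cvgD; exact: csum_cvg.
Qed.

Lemma csummableZ (c : C) f : csummable f -> csummable (fun x => c * f x).
Proof.
move=> fs; rewrite /csummable; under eq_fun do rewrite Normc.normcM.
exact: (nnsumZ (normc_ge0 _) fs).1.
Qed.

Lemma csumZ (c : C) f : csummable f -> csum (fun x => c * f x) = c * csum f.
Proof.
move=> fs; apply: csumE; first exact: csummableZ.
rewrite /has_csum (_ : summability.partial_sum _ =
   (fun F => (c : C^o) * summability.partial_sum (f : T -> C^o) F)); last first.
  by apply/funext => F; rewrite !partial_sumE mulr_sumr.
by apply: cvgMr; exact: csum_cvg.
Qed.

Lemma csummable0 : csummable (fun=> 0).
Proof. by rewrite /csummable; under eq_fun do rewrite Normc.normc0; exact: (nnsum0 R T).1. Qed.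

Lemma csum0 : csum (fun=> 0) = 0.
Proof.
rewrite -[RHS](mul0r (csum (fun=> 0))) -(csumZ 0 csummable0).
by apply: csum_ext => x; rewrite mul0r.
Qed.

Lemma csum_sum (I : Type) (r : seq I) (F : I -> T -> C) :
  (forall i, csummable (F i)) ->
  csummable (fun x => \sum_(i <- r) F i x) /\
  csum (fun x => \sum_(i <- r) F i x) = \sum_(i <- r) csum (F i).
Proof.
move=> Fs; elim: r => [|i r [IHs IHe]].
  under eq_fun do rewrite big_nil.
  by rewrite big_nil; split; [exact: csummable0|exact: csum0].
under eq_fun do rewrite big_cons.
by rewrite big_cons -IHe; split; [exact: csummableD|exact: csumD].
Qed.

(** The partial sums are eventually constant. *)
Lemma csum_finite f (F : {fset T}) : (forall x, x \notin F -> f x = 0) ->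
  csummable f /\ csum f = \sum_(x <- F) f x.
Proof.
move=> f0.
have sumG (V : zmodType) (g : T -> V) (G : {fset T}) : (forall x, x \notin F -> g x = 0) -> (F `<=` G)%fset ->
    \sum_(x <- G) g x = \sum_(x <- F) g x.
  move=> g0 FG; apply/esym/big_fset_incl => // x _; exact: g0.
have fs : csummable f.
  have [] // := @nnsum_le _ _ (fun x => normc (f x)) (\sum_(x <- F) normc (f x)) (fun=> normc_ge0 _).
  move=> G; rewrite -(@sumG _ (fun x => normc (f x)) (F `|` G)%fset).
  - rewrite [leRHS](big_fsetID _ (fun x => x \in G))/=.
    rewrite (_ : [fset x in (F `|` G)%fset | x \in G]%fset = G); last first.
      by apply/fsetP => x; rewrite !inE/=; case: (boolP (x \in G)); rewrite ?orbT ?andbF.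
    by rewrite lerDl sumr_ge0// => x _; exact: normc_ge0.
  - by move=> x xF; rewrite f0// Normc.normc0.
  - exact: fsubsetUl.
split=> //; apply: csumE => //; apply/has_csumP => e e0.
apply: (near_totally (F0 := F)) => G FG.
by rewrite (sumG _ f G f0 FG) subrr Normc.normc0.
Qed.

Lemma normc_csum_le f : csummable f -> normc (csum f) <= nnsum (fun x => normc (f x)).
Proof.
move=> fs; apply/ler_addgt0Pr => e e0.
have /has_csumP/(_ e e0) := csum_cvg fs.
move=> /filter_ex[F hF].
rewrite -(subrK (\sum_(x <- F) f x) (csum f)) (le_trans (ler_normcD _ _))//.
rewrite addrC lerD ?(ltW hF)// (le_trans (ler_normc_sum _ _))//.
exact: fsum_le_nnsum.
Qed.

End ComplexSums.

Lemma csum_exchange (R : realType) (T1 T2 : choiceType) (f : T1 -> T2 -> R[i]) :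
  (forall x, csummable (f x)) ->
  nnsummable (fun x => nnsum (fun y => normc (f x y))) ->
  csum (fun x => csum (f x)) = csum (fun y => csum (f^~ y)).
Proof.
move=> fs fss; rewrite /csum /=; congr (_ +i* _); apply: rsum_exchange.
- by move=> x; apply: csummableRe.
- have [] // := @nnsummable_le _ _ (fun x => nnsum (fun y => `|complex.Re (f x y)|)) _ _ fss.
  move=> x; rewrite nnsum_ge0 /=; last exact: csummableRe.
  by apply: (nnsummable_le _ (fs x)).2 => y; rewrite normr_ge0 Re_le_normc.
- by move=> x; apply: csummableIm.
- have [] // := @nnsummable_le _ _ (fun x => nnsum (fun y => `|complex.Im (f x y)|)) _ _ fss.
  move=> x; rewrite nnsum_ge0 /=; last exact: csummableIm.
  by apply: (nnsummable_le _ (fs x)).2 => y; rewrite normr_ge0 Im_le_normc.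
Qed.

Lemma csum_reindex (R : realType) (T T' : choiceType) (e : T -> T') (f : T' -> R[i]) :
  bijective e -> csum (fun x => f (e x)) = csum f.
Proof.
move=> be; rewrite /csum /rsum.
rewrite (nnsum_reindex (fun x => `|complex.Re (f x)| + complex.Re (f x)) be).1.
rewrite (nnsum_reindex (fun x => `|complex.Re (f x)|) be).1.
rewrite (nnsum_reindex (fun x => `|complex.Im (f x)| + complex.Im (f x)) be).1.
by rewrite (nnsum_reindex (fun x => `|complex.Im (f x)|) be).1.
Qed.

(** * Absolutely summable matrix families *)

Section MatrixNorm.
Variables (R : realType) (n : nat) (nu : 'M[R[i]]_n -> R).
Hypothesis nuP : submult_norm nu.
Implicit Types A B : 'M[R[i]]_n.

Lemma nuD A B : nu (A + B) <= nu A + nu B.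
Proof. by case: nuP. Qed.

Lemma nuZ c A : nu (c *: A) = normc c * nu A.
Proof. by case: nuP. Qed.

Lemma nuM A B : nu (A *m B) <= nu A * nu B.
Proof. by case: nuP. Qed.

Lemma nu_eq0 A : nu A = 0 -> A = 0.
Proof. by case: nuP => h _ _ _; exact: h. Qed.

Lemma nu0 : nu 0 = 0.
Proof. by rewrite -(scale0r 0) nuZ Normc.normc0 mul0r. Qed.

Lemma nuN A : nu (- A) = nu A.
Proof. by rewrite -scaleN1r nuZ normcNE Normc.normc1 mul1r. Qed.

Lemma nu_ge0 A : 0 <= nu A.
Proof.
have := nuD A (- A); rewrite subrr nu0 nuN -mulr2n => h.
by rewrite -(pmulrn_lge0 _ (ltn0Sn 1)).
Qed.

Lemma nu_sum (I : Type) (r : seq I) (F : I -> 'M[R[i]]_n) :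
  nu (\sum_(i <- r) F i) <= \sum_(i <- r) nu (F i).
Proof.
elim: r => [|i r IH]; first by rewrite !big_nil nu0.
by rewrite !big_cons (le_trans (nuD _ _))// lerD2l.
Qed.

(** Sandwiching [A] between two matrix units isolates one entry, so that
    submultiplicativity alone bounds the entries. *)
Lemma entry_le_nu : exists2 K : R, 0 <= K & forall A i j, normc (A i j) <= K * nu A.
Proof.
pose d (i j : 'I_n) : 'M[R[i]]_n := delta_mx i j.
(* Summing over all positions makes the constant independent of the entry. *)
exists (\sum_i \sum_j nu (d i i) * nu (d j i) / nu (d i i)).
  by do 2!(apply: sumr_ge0 => ? _); rewrite divr_ge0 ?mulr_ge0 ?nu_ge0.
move=> A i j.
have dpos : 0 < nu (d i i).
  rewrite lt_def nu_ge0 andbT; apply/eqP => /nu_eq0 /matrixP/(_ i i).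
  by rewrite !mxE !eqxx => /eqP; rewrite oner_eq0.
have h : normc (A i j) <= nu (d i i) * nu (d j i) / nu (d i i) * nu A.
  rewrite -mulrA [_^-1 * _]mulrC mulrA ler_pdivlMr//.
  rewrite -nuZ (_ : A i j *: d i i = d i i *m A *m d j i).
    rewrite (le_trans (nuM _ _))// mulrAC ler_wpM2r ?nu_ge0// nuM//.
  apply/matrixP => k l; rewrite !mxE (bigD1 j)//= big1 ?addr0.
    rewrite !mxE (bigD1 i)//= big1 ?addr0 ?mxE ?eqxx.
      by rewrite !andbT mulrC; case: (k == i); case: (l == i); rewrite ?(mulr1,mul1r,mulr0,mul0r).
    by move=> m mi; rewrite !mxE (negbTE mi) andbF mul0r.
  by move=> m mj; rewrite [d j i m l]mxE (negbTE mj) mulr0.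
apply: le_trans h _; rewrite ler_wpM2r ?nu_ge0//.
have pos k l : 0 <= nu (d k k) * nu (d l k) / nu (d k k).
  by rewrite divr_ge0 ?mulr_ge0 ?nu_ge0.
rewrite (bigD1 i)//= (bigD1 j)//= -addrA lerDl addr_ge0 ?sumr_ge0// => k _.
by rewrite sumr_ge0.
Qed.

Lemma nu_le_entries : exists2 K : R, 0 <= K &
  forall A, nu A <= K * \sum_i \sum_j normc (A i j).
Proof.
pose d (i j : 'I_n) : 'M[R[i]]_n := delta_mx i j.
have Kpos i : 0 <= \sum_j nu (d i j) by rewrite sumr_ge0// => j _; exact: nu_ge0.
exists (\sum_i \sum_j nu (d i j)); first by rewrite sumr_ge0.
move=> A; rewrite {1}(matrix_sum_delta A) (le_trans (nu_sum _ _))// mulr_sumr.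
apply: ler_sum => i _; rewrite (le_trans (nu_sum _ _))// mulr_sumr.
apply: ler_sum => j _; rewrite nuZ mulrC ler_wpM2r ?normc_ge0//.
rewrite (bigD1 i)//= (bigD1 j)//= -addrA lerDl addr_ge0 ?sumr_ge0// => *; exact: nu_ge0.
Qed.

End MatrixNorm.

Section MatrixSums.
Variables (R : realType) (n : nat) (nu : 'M[R[i]]_n -> R).
Hypothesis nuP : submult_norm nu.
Local Notation M := 'M[R[i]]_n.

Definition msummable (T : choiceType) (A : T -> M) := nnsummable (fun x => nu (A x)).

(** Entrywise, so that the value does not depend on the norm controlling the
    convergence. *)
Definition msum (T : choiceType) (A : T -> M) : M :=
  \matrix_(i, j) csum (fun x => A x i j).

Lemma msummable_entry (T : choiceType) (A : T -> M) i j : msummable A -> csummable (fun x => A x i j).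
Proof.
have [K K0 hK] := entry_le_nu nuP => As.
have [] // := @nnsummable_le _ _ (fun x => normc (A x i j)) _ _ (nnsumZ K0 As).1.
by move=> x; rewrite normc_ge0 hK.
Qed.

Lemma entry_msummable (T : choiceType) (A : T -> M) : (forall i j, csummable (fun x => A x i j)) -> msummable A.
Proof.
have [K K0 hK] := nu_le_entries nuP => As.
have s1 i := nnsum_sum (index_enum 'I_n) (fun j => As i j).
have [s2 _] := nnsum_sum (index_enum 'I_n) (fun i => (s1 i).1).
have [] // := @nnsummable_le _ _ (fun x => nu (A x)) _ _ (nnsumZ K0 s2).1.
by move=> x; rewrite nu_ge0//= hK.
Qed.

Lemma msum_ext (T : choiceType) (A B : T -> M) : A =1 B -> msum A = msum B.
Proof. by move=> /funext->. Qed.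

Lemma msummable_le (T : choiceType) (A : T -> M) (g : T -> R) :
  (forall x, nu (A x) <= g x) -> nnsummable g -> msummable A.
Proof.
move=> Ag gs; have [] // := @nnsummable_le _ _ (fun x => nu (A x)) _ _ gs.
by move=> x; rewrite nu_ge0//= Ag.
Qed.

Lemma msummableD (T : choiceType) (A B : T -> M) :
  msummable A -> msummable B -> msummable (fun x => A x + B x).
Proof.
by move=> As Bs; apply: msummable_le (nnsumD As Bs).1 => x; exact: nuD.
Qed.

Lemma msummableZ (T : choiceType) (c : R[i]) (A : T -> M) :
  msummable A -> msummable (fun x => c *: A x).
Proof.
move=> As; apply: msummable_le (nnsumZ (normc_ge0 c) As).1 => x; by rewrite nuZ.
Qed.

Lemma msumD (T : choiceType) (A B : T -> M) : msummable A -> msummable B ->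
  msum (fun x => A x + B x) = msum A + msum B.
Proof.
move=> As Bs; apply/matrixP => i j; rewrite !mxE -csumD; do ?exact: msummable_entry.
by apply: csum_ext => x; rewrite mxE.
Qed.

Lemma msumZ (T : choiceType) (c : R[i]) (A : T -> M) : msummable A ->
  msum (fun x => c *: A x) = c *: msum A.
Proof.
move=> As; apply/matrixP => i j; rewrite !mxE -csumZ; do ?exact: msummable_entry.
by apply: csum_ext => x; rewrite mxE.
Qed.

Lemma msumMl (T : choiceType) (B : M) (A : T -> M) : msummable A ->
  msum (fun x => B *m A x) = B *m msum A.
Proof.
move=> As; apply/matrixP => i j; rewrite !mxE.
have e k : B i k * msum A k j = csum (fun x => B i k * A x k j).
  by rewrite mxE csumZ//; exact: msummable_entry.
under eq_bigr do rewrite e.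
rewrite -(csum_sum (F := fun k x => B i k * A x k j) _ _).2; last first.
  by move=> k; apply: csummableZ; exact: msummable_entry.
by apply: csum_ext => x; rewrite mxE.
Qed.

Lemma msumMr (T : choiceType) (B : M) (A : T -> M) : msummable A ->
  msum (fun x => A x *m B) = msum A *m B.
Proof.
move=> As; apply/matrixP => i j; rewrite !mxE.
have e k : msum A i k * B k j = csum (fun x => B k j * A x i k).
  by rewrite mxE mulrC csumZ//; exact: msummable_entry.
under eq_bigr do rewrite e.
rewrite -(csum_sum (F := fun k x => B k j * A x i k) _ _).2; last first.
  by move=> k; apply: csummableZ; exact: msummable_entry.
by apply: csum_ext => x; rewrite mxE; apply: eq_bigr => k _; rewrite mulrC.
Qed.

Lemma msum_finite (T : choiceType) (A : T -> M) (F : {fset T}) : (forall x, x \notin F -> A x = 0) ->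
  msummable A /\ msum A = \sum_(x <- F) A x.
Proof.
move=> A0.
have h i j := @csum_finite _ _ (fun x => A x i j) F.
split; first by apply: entry_msummable => i j; apply: (h i j _).1 => x xF; rewrite A0// mxE.
apply/matrixP => i j; rewrite mxE summxE; apply: (h i j _).2 => x xF; by rewrite A0// mxE.
Qed.

(** The bound holds for finite partial sums; these converge entrywise, hence
    for [nu], which is dominated by the sum of the moduli of the entries. *)
Lemma nu_msum_le (T : choiceType) (A : T -> M) : msummable A ->
  nu (msum A) <= nnsum (fun x => nu (A x)).
Proof.
have [K K0 hK] := nu_le_entries nuP => As.
apply/ler_addgt0Pr => e e0.
(* There are n * n entries to control; the 1 keeps the denominator positive. *)
pose e' := e / (K * (n * n)%:R + 1).
have D0 : 0 < K * (n * n)%:R + 1 by rewrite ltr_wpDl// mulr_ge0.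
have e'0 : 0 < e' by rewrite divr_gt0.
have hnear : \forall F \near summability.totally, forall ij : 'I_n * 'I_n,
    normc (msum A ij.1 ij.2 - \sum_(x <- (F : {fset T})) A x ij.1 ij.2) < e'.
  apply: filter_forall => -[i j] /=; rewrite mxE.
  have /has_csumP := csum_cvg (msummable_entry i j As); exact.
have [F hF] := filter_ex hnear.
rewrite -(subrK (\sum_(x <- F) A x) (msum A)) (le_trans (nuD nuP _ _))// addrC lerD//.
  by rewrite (le_trans (nu_sum nuP _ _))// fsum_le_nnsum.
rewrite (le_trans (hK _))//.
have : \sum_i \sum_j normc ((msum A - \sum_(x <- F) A x) i j) <= (n * n)%:R * e'.
  have -> : (n * n)%:R * e' = \sum_(i < n) \sum_(j < n) e'.
    by rewrite !sumr_const !card_ord -mulrnA mulr_natl.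
  apply: ler_sum => i _; apply: ler_sum => j _; have := ltW (hF (i, j)).
  by rewrite /= !mxE summxE.
move=> h; rewrite (le_trans (ler_wpM2l K0 h))// mulrA /e' mulrA ler_pdivrMr//.
by rewrite mulrC (ler_wpM2l (ltW e0))// lerDl.
Qed.

Lemma msum_exchange (T1 T2 : choiceType) (A : T1 -> T2 -> M) :
  (forall x, msummable (A x)) ->
  nnsummable (fun x => nnsum (fun y => nu (A x y))) ->
  msum (fun x => msum (A x)) = msum (fun y => msum (A^~ y)).
Proof.
have [K K0 hK] := entry_le_nu nuP => As Ass.
apply/matrixP => i j; rewrite !mxE.
under csum_ext do rewrite mxE.
under [RHS]csum_ext do rewrite mxE.
apply: csum_exchange => [x|]; first exact: msummable_entry.
have [] // := @nnsummable_le _ _ (fun x => nnsum (fun y => normc (A x y i j))) _ _ (nnsumZ K0 Ass).1.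
move=> x; rewrite nnsum_ge0/=; last exact: msummable_entry.
rewrite -(nnsumZ K0 (As x)).2; apply: (nnsummable_le _ (nnsumZ K0 (As x)).1).2 => y.
by rewrite normc_ge0 hK.
Qed.

Lemma msum_reindex (T T' : choiceType) (e : T -> T') (A : T' -> M) :
  bijective e -> msum (fun x => A (e x)) = msum A.
Proof.
by move=> be; apply/matrixP => i j; rewrite !mxE (csum_reindex (fun x => A x i j) be).
Qed.

End MatrixSums.

(** * Tails of sums *)

Section Tails.
Variables (R : realType) (T : choiceType).

Definition off_fset (V : nmodType) (F : {fset T}) (f : T -> V) (x : T) : V :=
  if x \in F then 0 else f x.

Lemma nnsum_off (F : {fset T}) (g : T -> R) : nnsummable g ->
  nnsummable (off_fset F g) /\ nnsum (off_fset F g) <= nnsum g - \sum_(x <- F) g x.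
Proof.
move=> gs; apply: nnsum_le => [x|G].
  by rewrite /off_fset; case: ifP => // _; exact: nnsummable_ge0 gs.
rewrite lerBrDr (le_trans _ (fsum_le_nnsum (F `|` G)%fset gs))//.
rewrite [leRHS](big_fsetID _ (fun x => x \in F))/= addrC.
have -> : [fset x in (F `|` G)%fset | x \in F]%fset = F.
  by apply/fsetP => x; rewrite !inE/=; case: (x \in F); rewrite ?andbF.
rewrite lerD2r [leLHS](big_fsetID _ (fun x => x \in F))/= big_seq big1 ?add0r => [|x]; last first.
  by rewrite !inE/= /off_fset => /andP[_ ->].
have -> : [fset x in (F `|` G)%fset | x \notin F]%fset = [fset x in G | x \notin F]%fset.
  by apply/fsetP => x; rewrite !inE/=; case: (x \in F); rewrite ?andbF.
rewrite big_seq [leRHS]big_seq ler_sum// => x; rewrite !inE /= => /andP[_ /negbTE xF].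
by rewrite /off_fset xF.
Qed.

Lemma csum_off (F : {fset T}) (f : T -> R[i]) : csummable f ->
  csummable (off_fset F f) /\ csum f = \sum_(x <- F) f x + csum (off_fset F f).
Proof.
move=> fs.
have os : csummable (off_fset F f).
  have [] // := @nnsummable_le _ _ (fun x => normc (off_fset F f x)) _ _ fs.
  move=> x; rewrite normc_ge0 /off_fset /=; case: ifP => // _.
  by rewrite Normc.normc0 normc_ge0.
pose g x : R[i] := if x \in F then f x else 0.
have [gs ge] : csummable g /\ csum g = \sum_(x <- F) g x.
  by apply: csum_finite => x /negbTE xF; rewrite /g xF.
split=> //; rewrite (_ : \sum_(x <- F) f x = csum g); last first.
  by rewrite ge big_seq [RHS]big_seq; apply: eq_bigr => x xF; rewrite /g xF.
rewrite -csumD//; apply: csum_ext => x; rewrite /g /off_fset.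
by case: ifP; rewrite ?addr0 ?add0r.
Qed.

Lemma msum_off (n : nat) (nu : 'M[R[i]]_n -> R) (F : {fset T}) (f : T -> 'M[R[i]]_n) :
  submult_norm nu -> msummable nu f ->
  msummable nu (off_fset F f) /\ msum f = \sum_(x <- F) f x + msum (off_fset F f).
Proof.
move=> nuP fs.
have e i j x : off_fset F f x i j = off_fset F (fun x => f x i j) x.
  by rewrite /off_fset; case: ifP; rewrite ?mxE.
split.
  apply: entry_msummable => // i j; under eq_fun do rewrite e.
  by apply: (csum_off _ _).1; exact: msummable_entry fs.
apply/matrixP => i j; rewrite !mxE summxE (csum_off F (msummable_entry nuP i j fs)).2.
by congr (_ + _); apply: csum_ext => x; rewrite e.
Qed.

End Tails.

(** * Characters of the solenoid *)

Section SolenoidCharacters.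
Variable R : realType.
Implicit Types (u : solenoid R) (p q : rat).

Lemma sol_proj_neq0 u (N : nat) : sol_proj u N != 0.
Proof.
case: N => [|N]; first by rewrite sol_proj0 oner_neq0.
by apply/eqP => e; have := sol_circle u (ltn0Sn N); rewrite e Normc.normc0 => /eqP; rewrite eq_sym oner_eq0.
Qed.

Lemma normc_chi q u : normc (chi q u) = 1.
Proof.
have dq : (0 < `|denq q|)%N by rewrite absz_gt0 denq_eq0.
rewrite /chi; have := sol_circle u dq; move: (sol_proj u _) => z z1.
have zn (n : nat) : normc (z ^+ n) = 1.
  by elim: n => [|n IH]; rewrite ?expr0 ?Normc.normc1// exprS Normc.normcM z1 IH mulr1.
case: (numq q) => n; rewrite /exprz ?zn//.
by rewrite Normc.normcV zn invr1.
Qed.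

Lemma rat_frac q (m : nat) : (0 < m)%N ->
  q = (numq q * m%:Z)%:~R / (`|denq q| * m)%N%:R.
Proof.
move=> m0; have m0' : (m%:R : rat) != 0 by rewrite pnatr_eq0 -lt0n.
rewrite natrM intrM -pmulrn -mulf_div divff// mulr1 -{1}(divq_num_den q).
by congr (_ / _); rewrite -{1}(absz_denq q) -pmulrn.
Qed.

Lemma chiD p q u : chi (p + q) u = chi p u * chi q u.
Proof.
have dp : (0 < `|denq p|)%N by rewrite absz_gt0 denq_eq0.
have dq : (0 < `|denq q|)%N by rewrite absz_gt0 denq_eq0.
have N0 : (0 < `|denq p| * `|denq q|)%N by rewrite muln_gt0 dp.
have ep := rat_frac p dq; have eq := rat_frac q dp; rewrite mulnC in eq.
move: (numq p * _) (numq q * _) (_ * _)%N N0 ep eq => k l N N0 -> ->.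
by rewrite -mulrDl -intrD !chi_fracE// expfzDr ?sol_proj_neq0.
Qed.

Lemma chi0 u : chi 0 u = 1.
Proof. by rewrite /chi expr0z. Qed.

End SolenoidCharacters.

Section OneParameterSubgroup.
Variable R : realType.

Definition expi (t : R) : R[i] := cos t +i* sin t.

Lemma expi0 : expi 0 = 1.
Proof. by rewrite /expi cos0 sin0. Qed.

Lemma expiD s t : expi (s + t) = expi s * expi t.
Proof.
rewrite /expi cosD sinD.
rewrite -[RHS]/((cos s * cos t - sin s * sin t) +i* (cos s * sin t + sin s * cos t)).
by rewrite [sin s * cos t + _]addrC.
Qed.

Lemma expipi : expi pi = -1.
Proof. by rewrite /expi cospi sinpi; apply/eqP; rewrite eq_complex /= oppr0 !eqxx. Qed.

Lemma normc_expi t : normc (expi t) = 1.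
Proof. by rewrite /expi /= cos2Dsin2 sqrtr1. Qed.

Lemma expi_neq0 t : expi t != 0.
Proof. by apply/eqP => e; have := normc_expi t; rewrite e Normc.normc0 => /eqP; rewrite eq_sym oner_eq0. Qed.

Lemma expiX t (k : nat) : expi t ^+ k = expi (t * k%:R).
Proof.
elim: k => [|k IH]; first by rewrite expr0 mulr0 expi0.
by rewrite exprS IH -expiD -[in RHS]natr1 mulrDr mulr1 addrC.
Qed.

Lemma expiXz t (k : int) : expi t ^ k = expi (t * k%:~R).
Proof.
case: k => k; first exact: expiX.
rewrite /exprz expiX NegzE mulrNz mulrN; apply: (mulIf (expi_neq0 (t * k.+1%:R))).
by rewrite mulVf ?expi_neq0// -expiD addNr expi0.
Qed.

(** The winding line through the identity, along which [chi q] is the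
    exponential of frequency [q]; at level [0] the division by zero gives the
    prescribed value [1]. *)
Definition winding_proj (t : R) (N : nat) : R[i] := expi (t / N%:R).

Lemma winding_proj0 t : winding_proj t 0 = 1.
Proof. by rewrite /winding_proj invr0 mulr0 expi0. Qed.

Lemma winding_circle t N : (0 < N)%N -> normc (winding_proj t N) = 1.
Proof. by rewrite normc_expi. Qed.

Lemma winding_bond t m N : (0 < m)%N -> (N %| m)%N ->
  winding_proj t m ^+ (m %/ N) = winding_proj t N.
Proof.
move=> m0 Nm; rewrite /winding_proj expiX; congr expi.
rewrite -mulrA; congr (_ * _).
have N0 : (0 < N)%N by exact: dvdn_gt0 m0 Nm.
have N0' : (N%:R : R) != 0 by rewrite pnatr_eq0 -lt0n.
have m0' : (m%:R : R) != 0 by rewrite pnatr_eq0 -lt0n.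
apply: (mulfI m0'); rewrite mulrA divff// mul1r; apply: (mulIf N0').
by rewrite -natrM divnK// -mulrA mulVf// mulr1.
Qed.

Definition winding (t : R) : solenoid R :=
  Solenoid (winding_proj0 t) (winding_circle t) (@winding_bond t).

Lemma chi_winding q t : chi q (winding t) = expi (t * ratr q).
Proof.
rewrite /chi /= /winding_proj expiXz; congr expi; rewrite -mulrA; congr (_ * _).
rewrite /ratr mulrC; congr (_ * _^-1).
by rewrite -{2}(absz_denq q) -pmulrn.
Qed.

(** Average a function with its translate by [h], twisted so as to fix the
    frequency [q]. Each coefficient is multiplied by a factor of modulus at most
    1, and the factor vanishes at [p0] when [h] is half a period of
    [p0 - q]. Iterating removes any finite set of frequencies. *)
Lemma kill_frequencies (a : rat -> R[i]) (q : rat) (s : seq rat) :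
  csummable a -> q \notin s ->
  (forall t, csum (fun p => a p * expi (t * ratr p)) = 0) ->
  exists b : rat -> R[i], [/\ forall p, normc (b p) <= normc (a p), b q = a q,
    forall p, p \in s -> b p = 0 &
    forall t, csum (fun p => b p * expi (t * ratr p)) = 0].
Proof.
move=> as_ + a0; elim: s => [_|p0 s IH]; first by exists a; split.
rewrite inE negb_or => /andP[qp0 /IH[b [ba bq bs b0]]].
have half : (2 : R[i]) != 0 by rewrite pnatr_eq0.
pose h : R := pi / ratr (p0 - q).
pose avg p := (1 + expi (h * ratr (p - q))) / 2.
have avgq : avg q = 1 by rewrite /avg subrr rmorph0 mulr0 expi0 divff.
have avgp0 : avg p0 = 0.
  rewrite /avg /h mulfVK ?expipi ?subrr ?mul0r//.
  by rewrite fmorph_eq0 subr_eq0 eq_sym.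
have avg1 p : normc (avg p) <= 1.
  rewrite /avg Normc.normcM.
  have -> : normc (2^-1 : R[i]) = 2^-1.
    by rewrite Normc.normcV -[2]/(1 + 1) /= addr0 expr0n /= addr0 sqrtr_sqr ger0_norm.
  rewrite ler_pdivrMr// mul1r (le_trans (ler_normcD _ _))// Normc.normc1 normc_expi.
  by rewrite -[2]/(1 + 1).
exists (fun p => b p * avg p); split.
- move=> p; rewrite Normc.normcM -[leRHS]mulr1 ler_pM ?normc_ge0//.
- by rewrite avgq mulr1.
- by move=> p; rewrite inE => /orP[/eqP->|/bs->]; rewrite ?avgp0 ?mulr0 ?mul0r.
- move=> t.
  have bts t' : csummable (fun p => b p * expi (t' * ratr p)).
    have [] // := @nnsummable_le _ _ (fun p => normc (b p * expi (t' * ratr p))) _ _ as_.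
    by move=> p; rewrite normc_ge0 Normc.normcM normc_expi mulr1/=.
  rewrite (csum_ext (g := fun p => 2^-1 * (b p * expi (t * ratr p)) +
      (2^-1 * expi (- h * ratr q)) * (b p * expi ((t + h) * ratr p)))); last first.
    move=> p.
    have -> : expi ((t + h) * ratr p) = expi (t * ratr p) * expi (h * ratr p).
      by rewrite -expiD -mulrDl.
    rewrite /avg (_ : expi (h * ratr (p - q)) = expi (- h * ratr q) * expi (h * ratr p)); last first.
      by rewrite -expiD rmorphB/= mulrBr mulNr addrC.
    by ring.
  by rewrite csumD ?csumZ ?b0 ?mulr0 ?addr0//; apply: csummableZ.
Qed.

End OneParameterSubgroup.

(** * Fourier coefficients *)

Section ScalarExpansions.
Variable R : realType.
Implicit Types (a b : rat -> R[i]) (f : solenoid R -> R[i]).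

Lemma csummable_chi a u : csummable a -> csummable (fun q => a q * chi q u).
Proof.
rewrite /csummable => as_; under eq_fun do rewrite Normc.normcM normc_chi mulr1.
exact: as_.
Qed.

Lemma wiener_expansionP a f : wiener_expansion a f <->
  csummable a /\ forall u, f u = csum (fun q => a q * chi q u).
Proof.
split=> [[as_ af]|[as_ af]].
  have as' : csummable a by split=> // x; exact: normc_ge0.
  split=> // u; apply/esym; apply: csumE; [exact: csummable_chi|exact: af].
split; first by case: as_.
by move=> u; rewrite af; apply: csum_cvg; exact: csummable_chi.
Qed.

(** Kill all frequencies other than [q] in a finite set carrying almost all of
    the mass of [a]. Then [a q] and a tail of arbitrarily small mass cancel. *)
Lemma expansion0 a : csummable a ->
  (forall u, csum (fun q => a q * chi q u) = 0) -> forall q, a q = 0.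
Proof.
move=> as_ a0 q; apply: Normc.eq0_normc; apply/eqP; rewrite eq_le normc_ge0 andbT.
apply/ler_addgt0Pr => e e0; rewrite add0r.
have [F hF] := filter_ex (nnsum_approx as_ e0).
pose F' := (q |` F)%fset.
have qs : q \notin [seq p <- (F : seq rat) | p != q] by rewrite mem_filter eqxx.
have aw t : csum (fun p => a p * expi (t * ratr p)) = 0.
  by rewrite -[RHS](a0 (winding t)); apply: csum_ext => p; rewrite chi_winding.
have [b [ba bq bF b0]] := kill_frequencies as_ qs aw.
have bs : csummable b.
  have [] // := @nnsummable_le _ _ (fun p => normc (b p)) _ _ as_.
  by move=> p; rewrite normc_ge0 ba.
have := b0 0; rewrite (csum_ext (g := b)) => [|p]; last by rewrite mul0r expi0 mulr1.
rewrite (csum_off F' bs).2 (big_fsetD1 q) ?fset1U1//= big_seq big1 ?addr0; last first.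
  by move=> p; rewrite !inE => /andP[pq]; rewrite (negbTE pq)/= => pF; apply: bF; rewrite mem_filter pq.
rewrite bq => /eqP; rewrite addr_eq0 => /eqP ->; rewrite normcNE.
rewrite (le_trans (normc_csum_le (csum_off F' bs).1))//.
have [os oe] := nnsum_off F' as_.
apply: le_trans (_ : nnsum (off_fset F' (fun x => normc (a x))) <= _).
  apply: (nnsummable_le _ os).2 => p; rewrite normc_ge0 /off_fset /=.
  by case: ifP; rewrite ?Normc.normc0.
rewrite (le_trans oe)// lerBlDr -lerBlDl (le_trans (ltW hF))//.
rewrite [leRHS](big_fsetID _ (fun x => x \in F))/=.
have -> : [fset x in F' | x \in F]%fset = F.
  by apply/fsetP => x; rewrite !inE/=; case: (x \in F); rewrite ?andbF ?orbT.
by rewrite lerDl sumr_ge0// => x _; exact: normc_ge0.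
Qed.

Lemma wcoefE a f : wiener_expansion a f -> wcoef f = a.
Proof.
move=> af; have bf : wiener_expansion (wcoef f) f by exact: (@xgetI _ 0 [set a | wiener_expansion a f] a af).
move: (wcoef f) bf => b /wiener_expansionP[bs bf].
move/wiener_expansionP: af => [as_ af].
have s : csummable (fun q => b q + -1 * a q) by apply: csummableD => //; exact: csummableZ.
apply/funext => q; apply/eqP; rewrite -subr_eq0 -mulN1r; apply/eqP.
apply: (expansion0 s) => u.
rewrite (csum_ext (g := fun q => b q * chi q u + -1 * (a q * chi q u))) => [|p]; last first.
  by rewrite mulrDl mulrA.
rewrite csumD ?csumZ -?af -?bf ?mulN1r ?subrr//; do ?apply: csummableZ; exact: csummable_chi.
Qed.

End ScalarExpansions.

(** This set, the coefficients, the norm and the truncation are sealed, so that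
    elements of the algebra are compared through their coefficients only and
    never through the entries of their values. *)
HB.lock Definition wiener_mx (R : realType) (n : nat) :
  set (solenoid R -> 'M[R[i]]_n) := mx_over (@wiener R).

HB.lock Definition wiener_coef (R : realType) (n : nat)
  (f : solenoid R -> 'M[R[i]]_n) : rat -> 'M[R[i]]_n := mx_wcoef f.

HB.lock Definition wiener_norm (R : realType) (n : nat) (nu : 'M[R[i]]_n -> R)
  (f : solenoid R -> 'M[R[i]]_n) : R := wnorm nu f.

Lemma wiener_mxE (R : realType) (n : nat) : @mx_over R n (@wiener R) = @wiener_mx R n.
Proof. by rewrite wiener_mx.unlock. Qed.

Lemma wiener_normE (R : realType) (n : nat) (nu : 'M[R[i]]_n -> R) :
  wnorm nu = wiener_norm nu.
Proof. by rewrite wiener_norm.unlock. Qed.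

Section MatrixExpansions.
Variables (R : realType) (n : nat) (nu : 'M[R[i]]_n -> R).
Hypothesis nuP : submult_norm nu.
Local Notation M := 'M[R[i]]_n.
Local Notation W := (@wiener_mx R n).
Local Notation N := (wiener_norm nu).
Implicit Types (A B : rat -> M) (f g : solenoid R -> M).

Definition synth A : solenoid R -> M := fun u => msum (fun q => chi q u *: A q).

Lemma msummable_chi A u : msummable nu A -> msummable nu (fun q => chi q u *: A q).
Proof.
rewrite /msummable => As.
by under eq_fun do rewrite nuZ// normc_chi mul1r.
Qed.

Lemma synth_entry A i j : msummable nu A ->
  wiener_expansion (fun q => A q i j) (entry (synth A) i j).
Proof.
move=> As; apply/wiener_expansionP; split; first exact: msummable_entry As.
by move=> u; rewrite /entry mxE; apply: csum_ext => q; rewrite mxE mulrC.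
Qed.

Lemma synth_in A : msummable nu A -> W (synth A).
Proof. by move=> As; rewrite wiener_mx.unlock => i j; exists (fun q => A q i j); exact: synth_entry. Qed.

Lemma wiener_coef_synth A : msummable nu A -> wiener_coef (synth A) = A.
Proof.
move=> As; apply/funext => q; apply/matrixP => i j.
by rewrite wiener_coef.unlock mxE (wcoefE (synth_entry i j As)).
Qed.

Lemma wiener_mx_coef f : W f -> msummable nu (wiener_coef f) /\ f = synth (wiener_coef f).
Proof.
rewrite wiener_mx.unlock => Wf.
have h i j : wiener_expansion (fun q => wiener_coef f q i j) (entry f i j).
  have [a af] := Wf i j; under eq_fun do rewrite wiener_coef.unlock mxE.
  by rewrite (wcoefE af).
split.
  by apply: entry_msummable => // i j; have /wiener_expansionP[] := h i j.
apply/funext => u; apply/matrixP => i j; rewrite mxE.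
have /wiener_expansionP[_ /(_ u)] := h i j.
by rewrite /entry => ->; apply: csum_ext => q; rewrite [RHS]mxE mulrC.
Qed.

Lemma wiener_norm_sum f : N f = nnsum (fun q => nu (wiener_coef f q)).
Proof. by rewrite wiener_norm.unlock wiener_coef.unlock. Qed.

Lemma wiener_norm_synth A : msummable nu A -> N (synth A) = nnsum (fun q => nu (A q)).
Proof. by move=> As; rewrite wiener_norm_sum wiener_coef_synth. Qed.

Lemma synth_lin (c : R[i]) A B : msummable nu A -> msummable nu B ->
  msummable nu (fun q => c *: A q + B q) /\
  synth (fun q => c *: A q + B q) = c *: synth A + synth B.
Proof.
move=> As Bs; have cAs := msummableZ nuP c As; split; first exact: msummableD.
apply/funext => u.
rewrite -[RHS]/(c *: synth A u + synth B u) /synth -(msumZ nuP)//; last exact: msummable_chi.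
rewrite -(msumD nuP); last 2 first.
- by apply: msummableZ => //; exact: msummable_chi.
- exact: msummable_chi.
by apply: msum_ext => q; rewrite scalerDr !scalerA mulrC.
Qed.

Lemma wiener_mx_lin (c : R[i]) f g : W f -> W g -> W (c *: f + g).
Proof.
move=> /wiener_mx_coef[fs ->] /wiener_mx_coef[gs ->]; have [s <-] := synth_lin c fs gs.
exact: synth_in.
Qed.

Lemma wiener_coef_lin (c : R[i]) f g q : W f -> W g ->
  wiener_coef (c *: f + g) q = c *: wiener_coef f q + wiener_coef g q.
Proof.
move=> /wiener_mx_coef[fs ef] /wiener_mx_coef[gs eg]; have [s e] := synth_lin c fs gs.
by rewrite {1}ef {1}eg -e (wiener_coef_synth s).
Qed.

Definition mconv A B (q : rat) : M := msum (fun p => A p *m B (q - p)).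

(** Tonelli, with the sum over [q] taken first: it is invariant under the
    translation by [p]. *)
Lemma mconv_bound A B : msummable nu A -> msummable nu B ->
  [/\ forall q, nnsummable (fun p => nu (A p) * nu (B (q - p))),
      nnsummable (fun q => nnsum (fun p => nu (A p) * nu (B (q - p)))) &
      nnsum (fun q => nnsum (fun p => nu (A p) * nu (B (q - p)))) =
        nnsum (fun q => nu (A q)) * nnsum (fun q => nu (B q))].
Proof.
move=> As Bs.
have bij (p : rat) : bijective (fun q : rat => q - p).
  by exists (fun q => q + p) => q; rewrite ?subrK ?addrK.
have s1 p : nnsummable (fun q => nu (A p) * nu (B (q - p))).
  by apply: (nnsumZ (nu_ge0 nuP _) _).1; apply: ((nnsum_reindex _ (bij p)).2 Bs).
have e1 p : nnsum (fun q => nu (A p) * nu (B (q - p))) = nu (A p) * nnsum (fun q => nu (B q)).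
  rewrite (nnsumZ (nu_ge0 nuP _) _).2; last by apply: ((nnsum_reindex _ (bij p)).2 Bs).
  by rewrite (nnsum_reindex (fun q => nu (B q)) (bij p)).1.
have [Bpos] := (nnsum_ge0 Bs, tt).
have s2 := nnsumZ Bpos As.
have s3 : nnsummable (fun p => nnsum (fun q => nu (A p) * nu (B (q - p)))).
  by under eq_fun do rewrite e1 mulrC; exact: s2.1.
have [h1 h2 h3] := nnsum_exchange s1 s3.
split=> //; rewrite h3; under [LHS]nnsum_eq do rewrite e1 mulrC.
by rewrite s2.2 mulrC.
Qed.

Lemma mconv_term A B q : msummable nu A -> msummable nu B ->
  msummable nu (fun p => A p *m B (q - p)).
Proof.
move=> As Bs; have [h _ _] := mconv_bound As Bs.
by apply: (msummable_le nuP) (h q) => p; exact: nuM.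
Qed.

Lemma mconv_nu A B : msummable nu A -> msummable nu B ->
  msummable nu (mconv A B) /\
  nnsum (fun q => nu (mconv A B q)) <= nnsum (fun q => nu (A q)) * nnsum (fun q => nu (B q)).
Proof.
move=> As Bs; have [h1 h2 h3] := mconv_bound As Bs.
rewrite -h3; apply: nnsummable_le h2 => q; rewrite nu_ge0//=.
rewrite (le_trans (nu_msum_le nuP (mconv_term q As Bs)))//.
by apply: (nnsummable_le _ (h1 q)).2 => p; rewrite nu_ge0//= nuM.
Qed.

(** The characters are multiplicative, so after exchanging the sums and
    translating the inner index by [p] the double sum factors. *)
Lemma synthM A B : msummable nu A -> msummable nu B ->
  synth (mconv A B) = synth A * synth B.
Proof.
move=> As Bs; apply/funext => u; rewrite -[RHS]/(synth A u *m synth B u).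
have [h1 h2 _] := mconv_bound As Bs.
pose t (q p : rat) := (chi p u *: A p) *m (chi (q - p) u *: B (q - p)).
have nut q p : nu (t q p) <= nu (A p) * nu (B (q - p)).
  by rewrite (le_trans (nuM nuP _ _))// !nuZ// !normc_chi !mul1r.
have ts q : msummable nu (t q) by apply: (msummable_le nuP) (h1 q); exact: nut.
transitivity (msum (fun q => msum (t q))).
  apply: msum_ext => q; rewrite /mconv -(msumZ nuP); last exact: mconv_term.
  apply: msum_ext => p; rewrite /t -scalemxAl -scalemxAr scalerA -chiD.
  by rewrite [p + _]addrC subrK.
rewrite (msum_exchange nuP) //; last first.
  have [] // := @nnsummable_le _ _ (fun q => nnsum (fun p => nu (t q p))) _ _ h2.
  move=> q; rewrite nnsum_ge0//=; last exact: ts.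
  by apply: (nnsummable_le _ (h1 q)).2 => p; rewrite nu_ge0//= nut.
rewrite /(synth A u) -(msumMr nuP); last exact: msummable_chi.
apply: msum_ext => p; rewrite /t.
have bij : bijective (fun q : rat => q - p).
  by exists (fun q => q + p) => q; rewrite ?subrK ?addrK.
rewrite (msum_reindex (fun q => (chi p u *: A p) *m (chi q u *: B q)) bij).
by rewrite (msumMl nuP)//; exact: msummable_chi.
Qed.

Definition unit_coef (q : rat) : M := if q == 0 then 1%:M else 0.

Lemma synth1 : msummable nu unit_coef /\ synth unit_coef = 1.
Proof.
have h0 q : q \notin [fset (0 : rat)]%fset -> unit_coef q = 0.
  by rewrite inE /unit_coef => /negbTE ->.
split; first exact: (msum_finite nuP h0).1.
apply/funext => u; rewrite /synth.
rewrite (@msum_finite _ _ _ nuP _ _ [fset (0 : rat)]%fset _).2 => [|q /h0 ->]; last by rewrite scaler0.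
by rewrite big_seq_fset1 chi0 scale1r /unit_coef eqxx.
Qed.

Lemma wiener_mx1 : W 1.
Proof. by have [s <-] := synth1; exact: synth_in. Qed.

Lemma wiener_coef1 : wiener_coef (1 : solenoid R -> M) = unit_coef.
Proof. by have [s <-] := synth1; exact: wiener_coef_synth. Qed.

Lemma wiener_mx0 : W 0.
Proof.
have := wiener_mx_lin (-1) wiener_mx1 wiener_mx1; rewrite scaleN1r addNr; exact.
Qed.

Lemma wiener_mxM f g : W f -> W g -> W (f * g) /\ N (f * g) <= N f * N g.
Proof.
move=> /wiener_mx_coef[fs ef] /wiener_mx_coef[gs eg].
have [s h] := mconv_nu fs gs.
rewrite {1 2}ef {1 2}eg -synthM//; split; first exact: synth_in.
by rewrite (wiener_norm_synth s) !wiener_norm_sum.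
Qed.

Lemma wiener_coefM f g : W f -> W g -> wiener_coef (f * g) = mconv (wiener_coef f) (wiener_coef g).
Proof.
move=> /wiener_mx_coef[fs ef] /wiener_mx_coef[gs eg].
by rewrite {1}ef {1}eg -synthM// wiener_coef_synth//; case: (mconv_nu fs gs).
Qed.

Definition Wplus f := W f /\ forall q, q < 0 -> wiener_coef f q = 0.

Lemma WplusP f : mx_over (@wiener_plus R) f <-> Wplus f.
Proof.
rewrite /Wplus wiener_mx.unlock wiener_coef.unlock; split=> [h|[Wf f0] i j].
  split=> [i j|q q0]; first by case: (h i j).
  by apply/matrixP => i j; rewrite !mxE; case: (h i j) => _; exact.
split; first exact: Wf.
by move=> q q0; have /matrixP/(_ i j) := f0 q q0; rewrite !mxE.
Qed.

End MatrixExpansions.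

(** * Resolvents of contractive bilinear maps *)

Section NatSums.
Variable R : realType.

Definition initial (J : nat) : {fset nat} := [fset j in iota 0 J]%fset.

Lemma in_initial J j : (j \in initial J) = (j < J)%N.
Proof. by rewrite !inE/= mem_iota. Qed.

Lemma sum_initial (V : nmodType) (f : nat -> V) J :
  \sum_(j <- initial J) f j = \sum_(j < J) f j.
Proof.
rewrite -(big_mkord xpredT f) /index_iota subn0; apply: perm_big.
by apply: uniq_perm => [||j]; rewrite ?fset_uniq ?iota_uniq// in_initial mem_iota.
Qed.

Lemma near_initial (P : {fset nat} -> Prop) :
  (\forall F \near summability.totally, P F) -> \forall J \near \oo, P (initial J).
Proof.
case=> F0 _ hF0; exists (\max_(j <- F0) j).+1 => // J /= hJ; apply: hF0.
apply/fsubsetP => j jF; rewrite in_initial; apply: leq_trans hJ.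
by rewrite ltnS (@leq_bigmax_seq _ _ xpredT id).
Qed.

Lemma nnsummable_geometric (C rho : R) : 0 <= C -> 0 <= rho < 1 ->
  nnsummable (fun j : nat => rho ^+ j * C).
Proof.
move=> C0 /andP[r0 r1].
have r1' : 0 < 1 - rho by rewrite subr_gt0.
have [] // := @nnsum_le _ _ (fun j : nat => rho ^+ j * C) ((1 - rho)^-1 * C) _ _.
  by move=> j; rewrite mulr_ge0// exprn_ge0.
move=> F; rewrite -mulr_suml ler_wpM2r// -[leRHS]mul1r ler_pdivlMr//.
have [J hJ] : exists J, (F `<=` initial J)%fset.
  exists (\max_(j <- F) j).+1; apply/fsubsetP => j jF.
  by rewrite in_initial ltnS (@leq_bigmax_seq _ _ xpredT id).
apply: le_trans (_ : (\sum_(j < J) rho ^+ j) * (1 - rho) <= _).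
  rewrite (ler_wpM2r (ltW r1'))// -(sum_initial (fun j => rho ^+ j)).
  rewrite [leRHS](big_fsetID _ (fun x => x \in F))/=.
  have -> : [fset x in initial J | x \in F]%fset = F.
    by apply/fsetP => j; rewrite !inE/= andbC; case: (boolP (j \in F)) => //= /(fsubsetP hJ); rewrite inE.
  by rewrite lerDl sumr_ge0// => j _; rewrite exprn_ge0.
have -> : (\sum_(j < J) rho ^+ j) * (1 - rho) = 1 - rho ^+ J.
  elim: J {hJ} => [|J IH]; first by rewrite big_ord0 mul0r expr0 subrr.
  by rewrite big_ord_recr/= mulrDl IH mulrBr mulr1 -exprSr addrA subrK.
by rewrite gerBl exprn_ge0.
Qed.

End NatSums.

(** Completeness is expressed through absolutely convergent series: this is what
    the exchange of sums provides and what the Neumann series asks for. *)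
Record complete_subspace (R : realType) (V : lmodType R[i]) (E : set V) (N : V -> R) : Prop := {
  subsp0 : E 0;
  subspP : forall (c : R[i]) x y, E x -> E y -> E (c *: x + y);
  subsp_norm_ge0 : forall x, E x -> 0 <= N x;
  subsp_norm_eq0 : forall x, E x -> N x = 0 -> x = 0;
  subsp_normD : forall x y, E x -> E y -> N (x + y) <= N x + N y;
  subsp_normZ : forall (c : R[i]) x, E x -> N (c *: x) = normc c * N x;
  subsp_complete : forall y : nat -> V, (forall j, E (y j)) ->
    nnsummable (fun j => N (y j)) ->
    exists2 z, E z & N (z - \sum_(j < J) y j) @[J --> \oo] --> 0 }.

Record contractive_bilinear (R : realType) (V : lmodType R[i]) (E : set V) (N : V -> R)
    (B : V -> V -> V) : Prop := {
  bilE : forall w x, E w -> E x -> E (B w x);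
  bill : forall (c : R[i]) w w' x, E w -> E w' -> E x ->
    B (c *: w + w') x = c *: B w x + B w' x;
  bilr : forall (c : R[i]) w x x', E w -> E x -> E x' ->
    B w (c *: x + x') = c *: B w x + B w x';
  bilN : forall w x, E w -> E x -> N (B w x) <= N w * N x }.

Section SubspaceTheory.
Variables (R : realType) (V : lmodType R[i]) (E : set V) (N : V -> R).
Hypothesis EN : complete_subspace E N.
Implicit Types (x y w : V).

Lemma subspD x y : E x -> E y -> E (x + y).
Proof. by move=> Ex Ey; rewrite -[x]scale1r; exact: (subspP EN). Qed.

Lemma subspZ (c : R[i]) x : E x -> E (c *: x).
Proof. by move=> Ex; rewrite -[_ *: _]addr0; apply: (subspP EN) => //; exact: subsp0 EN. Qed.

Lemma subspN x : E x -> E (- x).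
Proof. by rewrite -scaleN1r; exact: subspZ. Qed.

Lemma subspB x y : E x -> E y -> E (x - y).
Proof. by move=> Ex Ey; apply: subspD => //; exact: subspN. Qed.

Lemma subsp_sum (I : Type) (r : seq I) (F : I -> V) : (forall i, E (F i)) -> E (\sum_(i <- r) F i).
Proof.
move=> EF; elim: r => [|i r IH]; first by rewrite big_nil; exact: subsp0 EN.
by rewrite big_cons; exact: subspD.
Qed.

Lemma subsp_norm0 : N 0 = 0.
Proof. by rewrite -(scale0r 0) (subsp_normZ EN) ?Normc.normc0 ?mul0r//; exact: subsp0 EN. Qed.

Lemma subsp_normN x : E x -> N (- x) = N x.
Proof. by move=> Ex; rewrite -scaleN1r (subsp_normZ EN)// normcNE Normc.normc1 mul1r. Qed.

Lemma subsp_normB x y : E x -> E y -> N (x - y) <= N x + N y.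
Proof.
move=> Ex Ey; rewrite -[in leRHS](subsp_normN Ey); apply: (subsp_normD EN) => //; exact: subspN.
Qed.

Section Bilinear.
Variable B : V -> V -> V.
Hypothesis HB : contractive_bilinear E N B.

Lemma bilDl w w' x : E w -> E w' -> E x -> B (w + w') x = B w x + B w' x.
Proof. by move=> Ew Ew' Ex; have := bill HB 1 Ew Ew' Ex; rewrite !scale1r. Qed.

Lemma bilDr w x x' : E w -> E x -> E x' -> B w (x + x') = B w x + B w x'.
Proof. by move=> Ew Ex Ex'; have := bilr HB 1 Ew Ex Ex'; rewrite !scale1r. Qed.

Lemma bil0r w : E w -> B w 0 = 0.
Proof.
move=> Ew; have E0 := subsp0 EN.
have := bilDr Ew E0 E0; rewrite addr0 => /eqP.
by rewrite -subr_eq0 opprD addNKr oppr_eq0 => /eqP.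
Qed.

Lemma bilZr (c : R[i]) w x : E w -> E x -> B w (c *: x) = c *: B w x.
Proof.
by move=> Ew Ex; rewrite -[c *: x]addr0 (bilr HB)//; [rewrite bil0r ?addr0|exact: subsp0 EN].
Qed.

Lemma bilNr w x : E w -> E x -> B w (- x) = - B w x.
Proof. by move=> Ew Ex; rewrite -scaleN1r bilZr// scaleN1r. Qed.

Lemma bilBr w x x' : E w -> E x -> E x' -> B w (x - x') = B w x - B w x'.
Proof. by move=> Ew Ex Ex'; rewrite bilDr ?bilNr//; exact: subspN. Qed.

(** The Neumann series of [- B w] applied to [y]. Its partial sums [S J] solve the
    equation up to the error [it J], which tends to zero. *)
Lemma resolvent_exists w y : E w -> N w < 1 -> E y -> exists2 z, E z & z + B w z = y.
Proof.
move=> Ew w1 Ey; pose it j := iter j (fun x => - B w x) y.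
have Eit j : E (it j) by elim: j => // j IH; apply: subspN; exact: (bilE HB).
have w0 := subsp_norm_ge0 EN Ew.
have Nit j : N (it j) <= N w ^+ j * N y.
  elim: j => [|j IH]; first by rewrite expr0 mul1r.
  rewrite [it _]/= subsp_normN; last exact: (bilE HB).
  by rewrite (le_trans (bilN HB Ew (Eit j)))// exprS -mulrA ler_wpM2l.
have geo : nnsummable (fun j => N w ^+ j * N y).
  by apply: nnsummable_geometric; rewrite ?w0 ?(subsp_norm_ge0 EN).
have [|its _] := @nnsummable_le _ _ (fun j => N (it j)) _ _ geo.
  by move=> j; rewrite (subsp_norm_ge0 EN)//= Nit.
have [z Ez zlim] := subsp_complete EN Eit its.
exists z => //; apply/eqP; rewrite -subr_eq0; apply/eqP.
have Ed : E (z + B w z - y) by apply: subspB => //; apply: subspD => //; exact: (bilE HB).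
apply: (subsp_norm_eq0 EN Ed); apply/eqP; rewrite eq_le (subsp_norm_ge0 EN Ed) andbT.
pose S J := \sum_(j < J) it j.
have ES J : E (S J) by apply: subsp_sum => j.
have tele J : S J + B w (S J) = y - it J.
  rewrite /S; elim: J => [|J IH]; first by rewrite big_ord0 bil0r// addr0 subrr.
  rewrite big_ord_recr (bilDr Ew (ES J) (Eit J)) addrACA IH.
  by rewrite [it J.+1]iterS opprK addrA subrK.
apply/ler_addgt0Pr => e e0; rewrite add0r.
have lim0 : (1 + N w) * N (z - S J) + N w ^+ J * N y @[J --> \oo] --> (1 + N w) * 0 + 0 * N y.
  apply: cvgD; first exact: cvgMr.
  by apply: cvgMl; apply: cvg_expr; rewrite ger0_norm.
rewrite mulr0 mul0r addr0 in lim0.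
have /cvgrPdist_lt/(_ e e0)/filter_ex[J] := lim0.
rewrite sub0r normrN => hJ; apply: ltW; apply: le_lt_trans hJ.
apply: le_trans (ler_norm _).
have EzS : E (z - S J) by exact: subspB.
have -> : z + B w z - y = (z - S J) + B w (z - S J) - it J.
  rewrite (bilBr Ew Ez (ES J)) [in RHS]addrACA -opprD tele opprB -[RHS]addrA.
  by congr (_ + _); rewrite addrAC subrr add0r.
rewrite (le_trans (subsp_normB _ _))//; first by apply: subspD => //; exact: (bilE HB).
rewrite lerD ?Nit// (le_trans (subsp_normD EN _ _))//; first exact: (bilE HB).
by rewrite mulrDl mul1r lerD2l (bilN HB).
Qed.

Lemma resolvent_bound w z : E w -> N w < 1 -> E z -> N z <= (1 - N w)^-1 * N (z + B w z).
Proof.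
move=> Ew w1 Ez; have Bz := bilE HB Ew Ez.
rewrite mulrC ler_pdivlMr ?subr_gt0// mulrBr mulr1 lerBlDr.
rewrite -{1}(addrK (B w z) z) (le_trans (subsp_normB (subspD Ez Bz) Bz))// lerD2l.
by rewrite [leRHS]mulrC (bilN HB).
Qed.

Lemma resolvent_unique w z z' : E w -> N w < 1 -> E z -> E z' ->
  z + B w z = z' + B w z' -> z = z'.
Proof.
move=> Ew w1 Ez Ez' h; apply/eqP; rewrite -subr_eq0; apply/eqP.
have Ed := subspB Ez Ez'; apply: (subsp_norm_eq0 EN) => //; apply/eqP.
rewrite eq_le (subsp_norm_ge0 EN Ed) andbT (le_trans (resolvent_bound Ew w1 Ed))//.
by rewrite bilBr// addrACA -opprD h subrr subsp_norm0 mulr0.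
Qed.

Definition resolvent w y : V := xget 0 [set z | E z /\ z + B w z = y].

Lemma resolventP w y : E w -> N w < 1 -> E y ->
  E (resolvent w y) /\ resolvent w y + B w (resolvent w y) = y.
Proof.
move=> Ew w1 Ey; have [z Ez zy] := resolvent_exists Ew w1 Ey.
exact: (@xgetI _ 0 [set z | E z /\ z + B w z = y] z (conj Ez zy)).
Qed.

Lemma resolventE w y z : E w -> N w < 1 -> E z -> z + B w z = y -> resolvent w y = z.
Proof.
move=> Ew w1 Ez zy.
have Ey : E y by rewrite -zy; apply: subspD => //; exact: (bilE HB).
have [Er ry] := resolventP Ew w1 Ey.
by apply: (resolvent_unique Ew w1) => //; rewrite ry.
Qed.

Lemma resolventN w y : E w -> N w < 1 -> E y ->
  N (resolvent w y) <= (1 - N w)^-1 * N y.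
Proof.
move=> Ew w1 Ey; have [Er ry] := resolventP Ew w1 Ey.
by rewrite -[in leRHS]ry resolvent_bound.
Qed.

Lemma resolvent_linear (c : R[i]) w y y' : E w -> N w < 1 -> E y -> E y' ->
  resolvent w (c *: y + y') = c *: resolvent w y + resolvent w y'.
Proof.
move=> Ew w1 Ey Ey'; have [Er ry] := resolventP Ew w1 Ey.
have [Er' ry'] := resolventP Ew w1 Ey'.
apply: resolventE => //; first exact: (subspP EN).
by rewrite (bilr HB)// addrACA -scalerDr ry ry'.
Qed.

End Bilinear.
End SubspaceTheory.

(** * Analyticity of the resolvent *)

Section ResolventAnalytic.
Variables (R : realType) (V : lmodType R[i]) (E : set V) (N : V -> R).
Variables (B L : V -> V -> V) (e0 e w0 : V).
Hypotheses (EN : complete_subspace E N).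
Hypotheses (HB : contractive_bilinear E N B) (HL : contractive_bilinear E N L).
Hypotheses (Ee0 : E e0) (Ee : E e) (Ew0 : E w0) (Nw0 : N w0 < 1).

Local Notation S := (resolvent E B w0).

Lemma base_in x : E x -> E (S x).
Proof. by move=> Ex; case: (resolventP EN HB Ew0 Nw0 Ex). Qed.

Lemma base_norm x : E x -> N (S x) <= (1 - N w0)^-1 * N x.
Proof. by move=> Ex; exact: (resolventN EN HB). Qed.

Lemma base_lin (c : R[i]) x y : E x -> E y -> S (c *: x + y) = c *: S x + S y.
Proof. by move=> Ex Ey; exact: (resolvent_linear EN HB). Qed.

Lemma baseB x y : E x -> E y -> S (x - y) = S x - S y.
Proof.
by move=> Ex Ey; have := base_lin (-1) Ey Ex; rewrite !scaleN1r addrC [in RHS]addrC.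
Qed.

(** The term of degree [k] of the resolvent at [w0 + h] is
    (- S B_h)^k S e; this is its polarized form
    (-1)^k S B_(v 0) S B_(v 1) ... S e. *)
Fixpoint pert k : ('I_k -> V) -> V :=
  match k with
  | 0 => fun=> S e
  | k'.+1 => fun v => - S (B (v ord0) (pert (fun i : 'I_k' => v (lift ord0 i))))
  end.

(** Expanding [L (w0 + h) z] in [h] combines the term of degree [k] of [z] with
    that of degree [k - 1], because [L h] raises the degree by one. *)
Definition pert_out k : ('I_k -> V) -> V :=
  match k with
  | 0 => fun=> e0 + L w0 (S e)
  | k'.+1 => fun v => L w0 (pert v) + L (v ord0) (pert (fun i : 'I_k' => v (lift ord0 i)))
  end.

Lemma pertS k (v : 'I_k.+1 -> V) :
  pert v = - S (B (v ord0) (pert (fun i : 'I_k => v (lift ord0 i)))).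
Proof. by []. Qed.

Lemma pert_outS k (v : 'I_k.+1 -> V) :
  pert_out v = L w0 (pert v) + L (v ord0) (pert (fun i : 'I_k => v (lift ord0 i))).
Proof. by []. Qed.

Lemma pert_in k (v : 'I_k -> V) : (forall i, E (v i)) -> E (pert v).
Proof.
elim: k v => [|k IH] v Ev; first exact: base_in.
by apply: (subspN EN); apply: base_in; apply: (bilE HB) => //; exact: IH.
Qed.

Lemma update0 k (v : 'I_k.+1 -> V) (z : V) :
  [eta v with ord0 |-> z] ord0 = z /\
  (fun i : 'I_k => [eta v with ord0 |-> z] (lift ord0 i)) = (fun i => v (lift ord0 i)).
Proof. by split=> [|]; [by rewrite /= ?eqxx|apply/funext => i /=]. Qed.

Lemma updateS k (v : 'I_k.+1 -> V) (j : 'I_k) (z : V) :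
  [eta v with lift ord0 j |-> z] ord0 = v ord0 /\
  (fun i : 'I_k => [eta v with lift ord0 j |-> z] (lift ord0 i)) =
    [eta (fun i => v (lift ord0 i)) with j |-> z].
Proof.
split=> [//|]; apply/funext => i /=.
by rewrite (inj_eq lift_inj).
Qed.

Lemma update_in k (v : 'I_k -> V) (j : 'I_k) (z : V) :
  (forall i, E (v i)) -> E z -> forall i, E ([eta v with j |-> z] i).
Proof. by move=> Ev Ez i /=; case: ifP. Qed.

Lemma pert_multilinear k : multilinear_on E (@pert k).
Proof.
elim: k => [[]//|k IH] i v c x y Ev Ex Ey.
have Evl j : E (v (lift ord0 j)) by [].
have Exy : E (c *: x + y) by exact: (subspP EN).
rewrite !pertS scalerN -opprD; congr (- _).
case: (unliftP ord0 i) => [j ->|->].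
  rewrite !(updateS v j _).1 !(updateS v j _).2.
  rewrite IH// (bilr HB)//; do ?by apply: pert_in; exact: update_in.
  by rewrite base_lin//; apply: (bilE HB) => //; apply: pert_in; exact: update_in.
rewrite !(update0 v _).1 !(update0 v _).2.
have Ep := pert_in Evl.
by rewrite (bill HB)// base_lin//; exact: (bilE HB).
Qed.

Lemma pert_out_multilinear k : multilinear_on E (@pert_out k).
Proof.
case: k => [[]//|k] i v c x y Ev Ex Ey.
have Evl j : E (v (lift ord0 j)) by [].
have Exy : E (c *: x + y) by exact: (subspP EN).
have Eup z : E z -> E (pert [eta v with i |-> z]).
  by move=> Ez; apply: pert_in; exact: update_in.
rewrite !pert_outS pert_multilinear// (bilr HL c Ew0 (Eup _ Ex) (Eup _ Ey)) scalerDr [RHS]addrACA.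
congr (_ + _).
case: (unliftP ord0 i) => [j ->|->].
  rewrite !(updateS v j _).1 !(updateS v j _).2.
  by rewrite pert_multilinear// (bilr HL)//; apply: pert_in; exact: update_in.
rewrite !(update0 v _).1 !(update0 v _).2.
by rewrite (bill HL)//; exact: pert_in.
Qed.

Local Notation s := ((1 - N w0)^-1).

Lemma base_const_gt0 : 0 < s.
Proof. by rewrite invr_gt0 subr_gt0. Qed.

Lemma base_const_ge1 : 1 <= s.
Proof.
by rewrite invf_ge1 ?subr_gt0// gerBl (subsp_norm_ge0 EN).
Qed.

Lemma pert_norm k (v : 'I_k -> V) : (forall i, E (v i)) ->
  N (pert v) <= s ^+ k.+1 * N e * \prod_(i < k) N (v i).
Proof.
elim: k v => [|k IH] v Ev; first by rewrite big_ord0 mulr1 expr1 base_norm.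
have Ep : E (pert (fun i : 'I_k => v (lift ord0 i))) by apply: pert_in.
have EBp := bilE HB (Ev ord0) Ep.
rewrite /= (subsp_normN EN); last exact: base_in.
rewrite (le_trans (base_norm EBp))// exprS -!mulrA (ler_wpM2l (ltW base_const_gt0))//.
rewrite (le_trans (bilN HB (Ev ord0) Ep))// big_ord_recl.
rewrite [leRHS]mulrA [leRHS]mulrCA (ler_wpM2l (subsp_norm_ge0 EN (Ev ord0)))//.
exact: IH.
Qed.

(** One constant for all degrees: [N e0] occurs in degree 0 only, and in each
    degree [k] the remaining terms contribute at most twice [s ^+ k.+1 * N e]. *)
Definition pert_const (k : nat) : R := (N e0 + 2 * s * N e) * s ^+ k.

Lemma pert_out_norm k (v : 'I_k -> V) : (forall i, E (v i)) ->
  E (pert_out v) /\ N (pert_out v) <= pert_const k * \prod_(i < k) N (v i).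
Proof.
have Nw0_ge0 := subsp_norm_ge0 EN Ew0; have Ne_ge0 := subsp_norm_ge0 EN Ee.
have s0 := base_const_gt0; have s1 := base_const_ge1; have Ne0_ge0 := subsp_norm_ge0 EN Ee0.
have ESe : E (S e) by exact: base_in.
case: k v => [|k] v Ev.
  have ELe : E (L w0 (S e)) by exact: (bilE HL).
  split; first exact: (subspD EN).
  rewrite /pert_const big_ord0 expr0 !mulr1 (le_trans (subsp_normD EN Ee0 ELe))// lerD2l.
  rewrite (le_trans (bilN HL Ew0 ESe))//.
  have h1 := base_norm Ee.
  have h2 : N w0 * N (S e) <= N (S e) by exact: (ler_piMl (subsp_norm_ge0 EN ESe) (ltW Nw0)).
  have h3 : 0 <= s * N e by rewrite mulr_ge0// ltW.
  rewrite (le_trans h2)// (le_trans h1)// -mulrA ler_peMl//.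
  by rewrite ler1n.
have Evl i : E (v (lift ord0 i)) by [].
have Ep := pert_in Ev; have Epl := pert_in Evl.
have EL1 := bilE HL Ew0 Ep; have EL2 := bilE HL (Ev ord0) Epl.
split; first exact: (subspD EN).
rewrite (le_trans (subsp_normD EN EL1 EL2))//.
pose P := \prod_(i < k.+1) N (v i).
have P0 : 0 <= P by apply: prodr_ge0 => i _; exact: (subsp_norm_ge0 EN).
have h1 : N (L w0 (pert v)) <= s ^+ k.+2 * N e * P.
  rewrite (le_trans (bilN HL Ew0 Ep))// (le_trans _ (pert_norm Ev))//.
  exact: (ler_piMl (subsp_norm_ge0 EN Ep) (ltW Nw0)).
have h2 : N (L (v ord0) (pert (fun i : 'I_k => v (lift ord0 i)))) <= s ^+ k.+2 * N e * P.
  rewrite (le_trans (bilN HL (Ev ord0) Epl))// /P big_ord_recl.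
  rewrite (le_trans (ler_wpM2l (subsp_norm_ge0 EN (Ev ord0)) (pert_norm Evl)))//.
  rewrite mulrCA ler_wpM2r//; last first.
    by rewrite ler_wpM2r// [leRHS]exprS ler_peMl// exprn_ge0 ?ltW.
  by rewrite mulr_ge0 ?(subsp_norm_ge0 EN)// prodr_ge0// => i _; exact: (subsp_norm_ge0 EN).
rewrite (le_trans (lerD h1 h2))// -mulrDl ler_wpM2r// /pert_const mulrDl.
rewrite (_ : s ^+ k.+2 * N e + s ^+ k.+2 * N e = 2 * s * N e * s ^+ k.+1); last first.
  by rewrite [s ^+ k.+2]exprS; move: (s ^+ _) => t; ring.
by rewrite lerDr mulr_ge0// exprn_ge0// ltW.
Qed.

Section Remainder.
Variables (h : V) (Eh : E h) (Nh : N h < (1 - N w0) / 2).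

Let z := resolvent E B (w0 + h) e.
Let p k := pert (fun _ : 'I_k => h).
Let q k := pert_out (fun _ : 'I_k => h).
Let D m := z - \sum_(k < m) p k.

Lemma shifted_lt1 : N (w0 + h) < 1.
Proof.
rewrite (le_lt_trans (subsp_normD EN Ew0 Eh))// -ltrBrDl (lt_le_trans Nh)//.
by rewrite ler_pdivrMr// ler_peMr ?ler1n// subr_ge0 ltW.
Qed.

Lemma shiftedP : E z /\ z + B (w0 + h) z = e.
Proof. by apply: (resolventP EN HB) => //; [exact: (subspD EN)|exact: shifted_lt1]. Qed.

Lemma diag_in k : E (p k).
Proof. exact: pert_in. Qed.

Lemma remainder_in m : E (D m).
Proof. by apply: (subspB EN); [exact: shiftedP.1|apply: (subsp_sum EN) => k; exact: diag_in]. Qed.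

Lemma diag_sum_recl m : \sum_(k < m.+1) p k =
  S e - S (B h (\sum_(k < m) p k)).
Proof.
have -> : S e - S (B h (\sum_(k < m) p k)) =
   S e + \sum_(k < m) p k.+1.
  congr (_ + _); elim: m => [|m IH].
    by have := baseB Ee Ee; rewrite !subrr !big_ord0 (bil0r EN HB)// => ->; rewrite oppr0.
  have EB x : E x -> E (B h x) by exact: (bilE HB).
  have Es : E (\sum_(k < m) p k) by apply: (subsp_sum EN) => k; exact: diag_in.
  have EBs := EB _ Es; have EBp := EB _ (diag_in m).
  rewrite big_ord_recr (bilDr HB Eh Es (diag_in m)) [RHS]big_ord_recr /= -IH.
  by have := base_lin 1 EBs EBp; rewrite !scale1r => ->; rewrite opprD.
by rewrite big_ord_recl.
Qed.

(** The remainder of the perturbation series satisfies the same recursion as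
    its terms, so it decays geometrically. *)
Lemma remainder_recl m : D m.+1 = - S (B h (D m)).
Proof.
have [Ez ez] := shiftedP.
have Es : E (\sum_(k < m) p k) by apply: (subsp_sum EN) => k; exact: diag_in.
have EBz := bilE HB Eh Ez; have EBs := bilE HB Eh Es.
have zS : z = S e - S (B h z).
  rewrite -baseB//; apply/esym/(resolventE EN HB) => //.
  by rewrite -[in RHS]ez (bilDl HB)// addrA addrK.
rewrite /D diag_sum_recl {1}zS (bilBr EN HB)// baseB// !opprB.
by rewrite addrC addrA subrK.
Qed.

Lemma remainder_norm m : N (D m) <= 2^-1 ^+ m * N z.
Proof.
have s0 := base_const_gt0.
elim: m => [|m IH]; first by rewrite /D big_ord0 subr0 expr0 mul1r.
have EBD := bilE HB Eh (remainder_in m).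
rewrite remainder_recl (subsp_normN EN); last exact: base_in.
rewrite (le_trans (base_norm EBD))// exprS -mulrA.
rewrite (le_trans (ler_wpM2l (ltW s0) (bilN HB Eh (remainder_in m))))// [leLHS]mulrA.
have D0 := subsp_norm_ge0 EN (remainder_in m).
apply: ler_pM => //; first by rewrite mulr_ge0 ?(ltW s0)// (subsp_norm_ge0 EN).
by rewrite ler_pdivrMl ?subr_gt0// ltW.
Qed.

Lemma out_remainder m :
  e0 + L (w0 + h) z - \sum_(k < m.+1) q k =
  L w0 (D m.+1) + L h (D m).
Proof.
have [Ez ez] := shiftedP.
have Es j : E (\sum_(k < j) p k) by apply: (subsp_sum EN) => ?; exact: diag_in.
have -> : \sum_(k < m.+1) q k =
   e0 + (L w0 (\sum_(k < m.+1) p k) +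
         L h (\sum_(k < m) p k)).
  elim: m => [|m IH]; first by rewrite !big_ord_recl !big_ord0 !addr0 (bil0r EN HL)// addr0.
  have rB w j : E w -> L w (\sum_(k < j.+1) p k) = L w (\sum_(k < j) p k) + L w (p j).
    by move=> Ew; rewrite big_ord_recr (bilDr HL Ew (Es j) (diag_in j)).
  rewrite big_ord_recr IH (rB w0 m.+1 Ew0) (rB h m Eh).
  by rewrite -[LHS]addrA; congr (_ + _); rewrite [LHS]addrACA.
rewrite opprD addrACA subrr add0r (bilDl HL)// /D !(bilBr EN HL)//.
by rewrite opprD addrACA.
Qed.

Lemma pert_out_cvg : N (e0 + L (w0 + h) z - \sum_(k < m) q k)
  @[m --> \oo] --> 0.
Proof.
rewrite -(cvg_shiftS (fun m => N (e0 + L (w0 + h) z - \sum_(k < m) q k))).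
have bound m : 0 <= N (e0 + L (w0 + h) z - \sum_(k < m.+1) q k)
    <= 2^-1 ^+ m * (2 * N z).
  have E1 := bilE HL Ew0 (remainder_in m.+1); have E2 := bilE HL Eh (remainder_in m).
  rewrite out_remainder (subsp_norm_ge0 EN (subspD EN E1 E2))/=.
  have Nz0 := subsp_norm_ge0 EN shiftedP.1.
  have Nh1 : N h <= 1.
    apply/ltW/(lt_le_trans Nh); rewrite ler_pdivrMr// mul1r.
    by rewrite (le_trans (_ : _ <= 1)) ?ler1n// gerBl (subsp_norm_ge0 EN).
  have p0 k : 0 <= (2^-1 : R) ^+ k by rewrite exprn_ge0// invr_ge0.
  have b1 : N (L w0 (D m.+1)) <= 2^-1 ^+ m * N z.
    rewrite (le_trans (bilN HL Ew0 (remainder_in _)))// (@le_trans _ _ (N (D m.+1)))//.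
      by rewrite ler_piMl ?(subsp_norm_ge0 EN (remainder_in _))// ltW.
    rewrite (le_trans (remainder_norm m.+1))// ler_wpM2r// exprS ler_piMl//.
    by rewrite invf_le1 ?ler1n.
  have b2 : N (L h (D m)) <= 2^-1 ^+ m * N z.
    rewrite (le_trans (bilN HL Eh (remainder_in _)))// (le_trans _ (remainder_norm m))//.
    by rewrite ler_piMl ?(subsp_norm_ge0 EN (remainder_in _)).
  rewrite (le_trans (subsp_normD EN E1 E2))// (le_trans (lerD b1 b2))//.
  by rewrite -mulrDr -mulr2n mulr_natl.
apply: (squeeze_cvgr (f := fun=> 0)); [exact: nearW bound|exact: cvg_cst|].
rewrite -(mul0r (2 * N z)); apply: cvgMl; apply: cvg_expr.
by rewrite ger0_norm ?invr_ge0// invf_lt1 ?ltr1n.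
Qed.

End Remainder.

Lemma resolvent_analytic : analytic_at E N (fun w => e0 + L w (resolvent E B w e)) w0.
Proof.
have w1 : 0 < 1 - N w0 by rewrite subr_gt0.
have s0 := base_const_gt0.
(* On this ball [s * N h] is at most 1/2, where [s] bounds the norm of [S]. *)
exists ((1 - N w0) / 2), pert_const, pert_out; split.
- by rewrite divr_gt0.
- split.
    move=> k; rewrite /pert_const mulr_ge0 ?exprn_ge0 ?(ltW s0)//.
    by rewrite addr_ge0 ?mulr_ge0 ?(subsp_norm_ge0 EN)// ltW.
  rewrite (_ : (fun k => _) = geometric (N e0 + 2 * s * N e) 2^-1).
    by apply: is_cvg_geometric_series; rewrite ger0_norm ?invr_ge0// invf_lt1 ?ltr1n.
  apply/funext => k; rewrite /pert_const/= -mulrA -exprMn mulrA mulVf ?mul1r//.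
  exact: lt0r_neq0.
- exact: pert_out_multilinear.
- exact: pert_out_norm.
move=> h Eh Nh; split; last exact: pert_out_cvg.
have [Ez _] := shiftedP Eh Nh; apply: (subspD EN) => //; apply: (bilE HL) => //; exact: (subspD EN).
Qed.

End ResolventAnalytic.

(** * The Banach algebra of matrix functions *)

HB.lock Definition cut (R : realType) (n : nat) (Q : pred rat)
  (f : solenoid R -> 'M[R[i]]_n) : solenoid R -> 'M[R[i]]_n :=
  synth (fun q => if Q q then wiener_coef f q else 0).

Section WienerBanach.
Variables (R : realType) (n : nat) (nu : 'M[R[i]]_n -> R).
Hypothesis nuP : submult_norm nu.
Local Notation M := 'M[R[i]]_n.
Local Notation W := (@wiener_mx R n).
Local Notation N := (wiener_norm nu).
Implicit Types (A : rat -> M) (f g : solenoid R -> M).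

Lemma wiener_coef_inj f g : W f -> W g -> wiener_coef f =1 wiener_coef g -> f = g.
Proof.
by move=> /(wiener_mx_coef nuP)[_ {2}->] /(wiener_mx_coef nuP)[_ {2}->] /funext->.
Qed.

Lemma wiener_coefD f g q : W f -> W g -> wiener_coef (f + g) q = wiener_coef f q + wiener_coef g q.
Proof. by move=> Wf Wg; have := wiener_coef_lin nuP 1 q Wf Wg; rewrite !scale1r. Qed.

Lemma wiener_coef0 q : wiener_coef (0 : solenoid R -> M) q = 0.
Proof.
have := wiener_coef_lin nuP (-1) q (wiener_mx1 nuP) (wiener_mx1 nuP).
by rewrite !scaleN1r !addNr.
Qed.

Lemma wiener_coefZ (c : R[i]) f q : W f -> wiener_coef (c *: f) q = c *: wiener_coef f q.
Proof. by move=> Wf; have := wiener_coef_lin nuP c q Wf (wiener_mx0 nuP); rewrite wiener_coef0 !addr0. Qed.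

Lemma wiener_coefN f q : W f -> wiener_coef (- f) q = - wiener_coef f q.
Proof. by move=> Wf; rewrite -scaleN1r wiener_coefZ// scaleN1r. Qed.

Lemma wiener_mxD f g : W f -> W g -> W (f + g).
Proof. by move=> Wf Wg; have := wiener_mx_lin nuP 1 Wf Wg; rewrite scale1r. Qed.

Lemma wiener_mxN f : W f -> W (- f).
Proof. by move=> Wf; have := wiener_mx_lin nuP (-1) Wf (wiener_mx0 nuP); rewrite scaleN1r addr0. Qed.

Lemma wiener_mxB f g : W f -> W g -> W (f - g).
Proof. by move=> Wf Wg; exact: wiener_mxD Wf (wiener_mxN Wg). Qed.

Lemma wiener_coefB f g q : W f -> W g -> wiener_coef (f - g) q = wiener_coef f q - wiener_coef g q.
Proof. by move=> Wf Wg; rewrite (wiener_coefD q Wf (wiener_mxN Wg)) (wiener_coefN q Wg). Qed.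

Lemma wiener_mx_sum (I : Type) (r : seq I) (F : I -> solenoid R -> M) :
  (forall i, W (F i)) -> W (\sum_(i <- r) F i).
Proof.
move=> WF; elim: r => [|i r IH]; first by rewrite big_nil; exact: (wiener_mx0 nuP).
by rewrite big_cons; exact: wiener_mxD.
Qed.

Lemma wiener_coef_sum (I : Type) (r : seq I) (F : I -> solenoid R -> M) q :
  (forall i, W (F i)) -> wiener_coef (\sum_(i <- r) F i) q = \sum_(i <- r) wiener_coef (F i) q.
Proof.
move=> WF; elim: r => [|i r IH]; first by rewrite !big_nil wiener_coef0.
by rewrite !big_cons (wiener_coefD q (WF i) (wiener_mx_sum r WF)) IH.
Qed.

Lemma wiener_mx_msummable f : W f -> nnsummable (fun q => nu (wiener_coef f q)).
Proof. by case/(wiener_mx_coef nuP). Qed.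

(** The limit is formed coefficientwise; the coefficientwise tails are
    controlled by the tail of the series of norms after exchanging sums. *)
Lemma wiener_mx_complete (y : nat -> solenoid R -> M) : (forall j, W (y j)) ->
  nnsummable (fun j => N (y j)) ->
  exists2 z, W z & N (z - \sum_(j < J) y j) @[J --> \oo] --> 0.
Proof.
move=> Wy Ny.
pose t j q := nu (wiener_coef (y j) q).
have ts j : nnsummable (t j) by exact: wiener_mx_msummable.
have Nt j : N (y j) = nnsum (t j) by rewrite wiener_norm_sum.
have Nts : nnsummable (fun j => nnsum (t j)) by under eq_fun do rewrite -Nt.
have [tq tqs tqe] := nnsum_exchange ts Nts.
pose Z q := msum (fun j => wiener_coef (y j) q).
have Zs : msummable nu Z.
  by apply: (msummable_le nuP) tqs => q; apply: (nu_msum_le nuP); exact: tq.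
exists (synth Z); first exact: synth_in nuP _ Zs.
have Wz := synth_in nuP Zs.
pose S J := \sum_(j < J) y j.
have WS J : W (S J) by apply: wiener_mx_sum.
have bound J : 0 <= N (synth Z - S J) <= nnsum (fun j => N (y j)) - \sum_(j <- initial J) N (y j).
  have WzS := wiener_mxB Wz (WS J).
  rewrite [N (synth Z - S J)]wiener_norm_sum nnsum_ge0/=; last exact: wiener_mx_msummable.
  pose o j q := off_fset (initial J) (fun j => t j q) j.
  have oE j : o j = fun q => if j \in initial J then 0 else t j q by [].
  have os j : nnsummable (o j).
    by rewrite oE; case: (j \in initial J); [exact: (nnsum0 _ _).1|exact: ts].
  have on j : nnsum (o j) = off_fset (initial J) (fun j => N (y j)) j.
    by rewrite oE /off_fset; case: (j \in initial J); [exact: (nnsum0 _ _).2|rewrite Nt].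
  have [offs offe] := nnsum_off (initial J) Ny.
  have oss : nnsummable (fun j => nnsum (o j)) by under eq_fun do rewrite on.
  have [h1 h2 h3] := nnsum_exchange os oss.
  apply: le_trans offe; under [leRHS]nnsum_eq do rewrite -on.
  rewrite -h3; apply: (nnsummable_le _ h2).2 => q; rewrite nu_ge0//=.
  have -> : wiener_coef (synth Z - S J) q = msum (off_fset (initial J) (fun j => wiener_coef (y j) q)).
    rewrite wiener_coefB// (wiener_coef_synth nuP Zs) wiener_coef_sum// -(sum_initial (fun j => wiener_coef (y j) q)).
    by rewrite /Z (msum_off (initial J) nuP (tq q)).2 addrC addKr.
  have offnu j : nu (off_fset (initial J) (fun j => wiener_coef (y j) q) j) = o j q.
    by rewrite /o /off_fset; case: ifP; rewrite ?nu0.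
  rewrite (le_trans (nu_msum_le nuP (msum_off (initial J) nuP (tq q)).1))//.
  by under [leLHS]nnsum_eq do rewrite offnu.
apply/cvgrPdist_lt => e e0.
apply: filterS (near_initial (nnsum_approx Ny e0)) => J hJ.
have /andP[N0 Nb] := bound J.
rewrite sub0r normrN ger0_norm//; apply: le_lt_trans Nb _.
by rewrite ltrBlDr addrC -ltrBlDr.
Qed.

Lemma wiener_mx_banach : complete_subspace W N.
Proof.
split.
- exact: (wiener_mx0 nuP).
- by move=> c x y Wx Wy; exact: (wiener_mx_lin nuP c Wx Wy).
- by move=> x Wx; rewrite wiener_norm_sum; apply: nnsum_ge0; exact: wiener_mx_msummable.
- move=> x Wx Nx0; apply: (wiener_coef_inj Wx (wiener_mx0 nuP)) => q.
  rewrite wiener_coef0; apply: (nu_eq0 nuP); apply/eqP.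
  rewrite eq_le (nu_ge0 nuP) andbT -Nx0 wiener_norm_sum; exact: (le_nnsum1 q (wiener_mx_msummable Wx)).
- move=> x y Wx Wy; have xs := wiener_mx_msummable Wx; have ys := wiener_mx_msummable Wy.
  rewrite !wiener_norm_sum -(nnsumD xs ys).2.
  apply: (nnsummable_le _ (nnsumD xs ys).1).2 => q.
  by rewrite (nu_ge0 nuP) (wiener_coefD q Wx Wy) (nuD nuP).
- move=> c x Wx; have xs := wiener_mx_msummable Wx.
  rewrite !wiener_norm_sum -(nnsumZ (normc_ge0 c) xs).2.
  by apply: nnsum_eq => q; rewrite (wiener_coefZ c q Wx) (nuZ nuP).
- exact: wiener_mx_complete.
Qed.

Lemma cut_msummable Q f : W f -> msummable nu (fun q => if Q q then wiener_coef f q else 0).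
Proof.
move=> Wf; apply: (msummable_le nuP) (wiener_mx_msummable Wf) => q.
by case: ifP; rewrite ?nu0// nu_ge0.
Qed.

Lemma wiener_mx_cut Q f : W f -> W (cut Q f).
Proof. by move=> /(cut_msummable Q); rewrite cut.unlock; exact: synth_in. Qed.

Lemma wiener_coef_cut Q f q : W f -> wiener_coef (cut Q f) q = if Q q then wiener_coef f q else 0.
Proof. by move=> /(cut_msummable Q) s; rewrite cut.unlock (wiener_coef_synth nuP s). Qed.

Lemma cut_norm Q f : W f -> N (cut Q f) <= N f.
Proof.
move=> Wf; rewrite !wiener_norm_sum; apply: (nnsummable_le _ (wiener_mx_msummable Wf)).2 => q.
rewrite (nu_ge0 nuP) (wiener_coef_cut Q q Wf) /=.
by case: ifP => _; rewrite ?(nu0 nuP) ?(nu_ge0 nuP).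
Qed.

Lemma cut_lin Q (c : R[i]) f g : W f -> W g -> cut Q (c *: f + g) = c *: cut Q f + cut Q g.
Proof.
move=> Wf Wg; have Wcf := wiener_mx_cut Q Wf; have Wcg := wiener_mx_cut Q Wg.
have Wl := wiener_mx_lin nuP c Wf Wg.
apply: (wiener_coef_inj (wiener_mx_cut Q Wl) (wiener_mx_lin nuP c Wcf Wcg)) => q.
rewrite (wiener_coef_cut Q q Wl) (wiener_coef_lin nuP c q Wcf Wcg) (wiener_coef_cut Q q Wf) (wiener_coef_cut Q q Wg).
rewrite (wiener_coef_lin nuP c q Wf Wg).
by case: ifP; rewrite ?scaler0 ?addr0.
Qed.

Lemma bil_cut Q B : contractive_bilinear W N B ->
  contractive_bilinear W N (fun w y => cut Q (B w y)).
Proof.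
move=> HB; split.
- by move=> w x Ww Wx; apply: wiener_mx_cut; exact: (bilE HB).
- by move=> c w w' x Ww Ww' Wx; rewrite (bill HB)// cut_lin//; exact: (bilE HB).
- by move=> c w x x' Ww Wx Wx'; rewrite (bilr HB)// cut_lin//; exact: (bilE HB).
- by move=> w x Ww Wx; exact: le_trans (cut_norm Q (bilE HB Ww Wx)) (bilN HB Ww Wx).
Qed.

Lemma bil_opp B : contractive_bilinear W N B ->
  contractive_bilinear W N (fun w y => - B w y).
Proof.
move=> HB; split.
- by move=> w x Ww Wx; apply: wiener_mxN; exact: (bilE HB).
- by move=> c w w' x Ww Ww' Wx; rewrite (bill HB)// opprD scalerN.
- by move=> c w x x' Ww Wx Wx'; rewrite (bilr HB)// opprD scalerN.
- move=> w x Ww Wx; rewrite (subsp_normN wiener_mx_banach); [exact: (bilN HB)|exact: (bilE HB)].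
Qed.

Lemma bil_mull : contractive_bilinear W N (fun w y => w * y).
Proof.
split.
- by move=> w x Ww Wx; case: (wiener_mxM nuP Ww Wx).
- move=> c w w' x _ _ _; rewrite mulrDl; congr (_ + _).
  by apply/funext => u; rewrite -[RHS]/(c *: (w u *m x u)) scalemxAl.
- move=> c w x x' _ _ _; rewrite mulrDr; congr (_ + _).
  by apply/funext => u; rewrite -[RHS]/(c *: (w u *m x u)) scalemxAr.
- by move=> w x Ww Wx; case: (wiener_mxM nuP Ww Wx).
Qed.

Lemma bil_mulr : contractive_bilinear W N (fun w y => y * w).
Proof.
split.
- by move=> w x Ww Wx; exact: (bilE bil_mull).
- by move=> c w w' x Ww Ww' Wx; exact: (bilr bil_mull).
- by move=> c w x x' Ww Wx Wx'; exact: (bill bil_mull).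
- by move=> w x Ww Wx; rewrite mulrC; exact: (bilN bil_mull).
Qed.

Lemma LambdaW_near1 x : W x -> N (x - 1) < 1 -> LambdaW x.
Proof.
move=> Wx x1; have Ww := wiener_mxB Wx (wiener_mx1 nuP).
have [y Wy yx] := resolvent_exists wiener_mx_banach bil_mulr Ww x1 (wiener_mx1 nuP).
have [z Wz xz] := resolvent_exists wiener_mx_banach bil_mull Ww x1 (wiener_mx1 nuP).
have {}yx : y * x = 1 by rewrite -yx mulrBr mulr1 addrC subrK.
have {}xz : x * z = 1 by rewrite -xz mulrBl mul1r addrC subrK.
have yz : y = z by rewrite -[y]mulr1 -xz mulrA yx mul1r.
by rewrite /LambdaW wiener_mxE; split=> //; exists y => //; split=> //; rewrite yz.
Qed.

(** If [q] is negative, then [p] or [q - p] is, so every term of the convolution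
    vanishes. *)
Lemma WplusM f g : Wplus f -> Wplus g -> Wplus (f * g).
Proof.
move=> [Wf f0] [Wg g0]; split; first by case: (wiener_mxM nuP Wf Wg).
move=> q q0; rewrite (wiener_coefM nuP)//.
have -> : mconv (wiener_coef f) (wiener_coef g) q = msum (fun _ : rat => 0 : M).
  apply: msum_ext => p; have [p0|p0] := ltP p 0; first by rewrite f0// mul0mx.
  by rewrite g0 ?mulmx0// subr_lt0; exact: lt_le_trans p0.
by rewrite (@msum_finite _ _ _ nuP _ _ fset0 _).2 ?big_seq_fset0.
Qed.

Definition nonneg : pred rat := fun q => 0 <= q.
Definition negative : pred rat := fun q => q < 0.

Lemma Wplus_cut f : W f -> Wplus (cut nonneg f).
Proof.
move=> Wf; split; first exact: wiener_mx_cut.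
by move=> q q0; rewrite (wiener_coef_cut nonneg q Wf) /nonneg leNgt q0.
Qed.

Lemma cut_Wplus f : Wplus f -> cut nonneg f = f.
Proof.
case=> Wf f0; apply: (wiener_coef_inj (wiener_mx_cut nonneg Wf) Wf) => q.
rewrite (wiener_coef_cut nonneg q Wf); case: ifPn => //; rewrite -ltNge => q0.
by rewrite f0.
Qed.

Lemma Wplus1 : Wplus (1 : solenoid R -> M).
Proof.
split; first exact: wiener_mx1 nuP.
by move=> q q0; rewrite (wiener_coef1 nuP) /unit_coef lt_eqF.
Qed.

Lemma WplusD f g : Wplus f -> Wplus g -> Wplus (f + g).
Proof.
move=> [Wf f0] [Wg g0]; split; first exact: wiener_mxD.
by move=> q q0; rewrite (wiener_coefD q Wf Wg) f0// g0// addr0.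
Qed.

Lemma WplusB f g : Wplus f -> Wplus g -> Wplus (f - g).
Proof.
move=> [Wf f0] [Wg g0]; split; first exact: wiener_mxB.
by move=> q q0; rewrite (wiener_coefB q Wf Wg) f0// g0// subr0.
Qed.

Lemma cut_split f : W f -> f = cut negative f + cut nonneg f.
Proof.
move=> Wf; have Wneg := wiener_mx_cut negative Wf; have Wpos := wiener_mx_cut nonneg Wf.
apply: (wiener_coef_inj Wf (wiener_mxD Wneg Wpos)) => q.
rewrite (wiener_coefD q Wneg Wpos) (wiener_coef_cut negative q Wf) (wiener_coef_cut nonneg q Wf) /negative /nonneg.
by case: ltP; rewrite ?addr0 ?add0r.
Qed.

(** The Neumann series gives an inverse in the large algebra. To obtain one with
    nonnegative frequencies, solve the truncated equation z + P+(v z) = 1: its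
    solution has nonnegative frequencies, so v z has too, and the truncation can
    be dropped. *)
Lemma Wplus_unit v : Wplus v -> N v < 1 -> GLWplus (1 + v).
Proof.
move=> Pv v1; have Wv := Pv.1.
have solve (B : (solenoid R -> M) -> (solenoid R -> M) -> solenoid R -> M) :
    contractive_bilinear W N B -> (forall z, Wplus z -> Wplus (B v z)) ->
    exists2 z, Wplus z & z + B v z = 1.
  move=> HB Bp.
  have [z Wz ez] := resolvent_exists wiener_mx_banach (bil_cut nonneg HB) Wv v1 (wiener_mx1 nuP).
  have Pz : Wplus z.
    rewrite (_ : z = 1 - cut nonneg (B v z)); last by rewrite -ez addrK.
    by apply: WplusB; [exact: Wplus1|apply: Wplus_cut; exact: (bilE HB)].
  by exists z => //; rewrite -[X in _ + X](cut_Wplus (Bp z Pz)).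
have [y Py yv] := solve _ bil_mulr (fun z Pz => WplusM Pz Pv).
have [z Pz vz] := solve _ bil_mull (fun z Pz => WplusM Pv Pz).
have {}yv : y * (1 + v) = 1 by rewrite mulrDr mulr1.
have {}vz : (1 + v) * z = 1 by rewrite mulrDl mul1r.
have yz : y = z by rewrite -[y]mulr1 -vz mulrA yv mul1r.
split; first by apply/WplusP; apply: WplusD => //; exact: Wplus1.
by exists y; [exact/WplusP|split=> //; rewrite yz].
Qed.

Lemma wiener_minus0P f : wiener_minus0 nu f <-> W f /\ forall q, 0 <= q -> wiener_coef f q = 0.
Proof.
split=> [[a [a0 as_ af]]|[Wf f0]].
  have s : msummable nu a.
    split; first by move=> q; rewrite nu_ge0.
    rewrite esum_mkcond in as_; apply: le_lt_trans as_; apply: le_esum => q _.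
    case: ifPn; rewrite ?lexx// notin_setE /= => /negP; rewrite -leNgt => q0.
    by rewrite a0// nu0.
  have -> : f = synth a.
    apply/funext => u; apply/matrixP => i j; rewrite mxE.
    apply: (has_csum_unique (af u i j)).
    have sij := csummable_chi u (msummable_entry nuP i j s).
    rewrite (csum_ext (g := fun q => a q i j * chi q u)); first exact: csum_cvg sij.
    by move=> q; rewrite mxE mulrC.
  by rewrite (wiener_coef_synth nuP s); split; [exact: (synth_in nuP s)|exact: a0].
have [s ef] := wiener_mx_coef nuP Wf.
exists (wiener_coef f); split=> //.
  apply: le_lt_trans (proj2 s); rewrite esum_mkcond; apply: le_esum => q _.
  by case: ifP => // _; rewrite lee_fin nu_ge0.
move=> u i j; have sij := csummable_chi u (msummable_entry nuP i j s).
rewrite (_ : f u i j = csum (fun q => wiener_coef f q i j * chi q u)); first exact: csum_cvg sij.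
by rewrite {1}ef mxE; apply: csum_ext => q; rewrite mxE mulrC.
Qed.

End WienerBanach.

(** * The factorization *)

Lemma analytic_at_shift (R : realType) (V : lmodType R[i]) (E : set V) (N : V -> R)
    (F : V -> V) (x0 a : V) :
  analytic_at E N F (a - x0) -> analytic_at E N (fun g => F (g - x0)) a.
Proof.
case=> r [c [P [r0 hc hP hN hF]]]; exists r, c, P; split=> // h Eh Nh.
by rewrite addrAC; exact: hF.
Qed.

Section Factorization.
Variables (R : realType) (n : nat) (nu : 'M[R[i]]_n -> R).
Hypothesis nuP : submult_norm nu.
Local Notation M := 'M[R[i]]_n.
Local Notation W := (@wiener_mx R n).
Local Notation N := (wiener_norm nu).

(** The Toeplitz operator with symbol [w], compressed to the negative
    frequencies. *)
Definition Toeplitz (w y : solenoid R -> M) := cut negative (y * w).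

Definition minus_factor (w : solenoid R -> M) := resolvent W Toeplitz w 1.

Lemma Toeplitz_bil : contractive_bilinear W N Toeplitz.
Proof. exact: (bil_cut nuP negative (bil_mulr nuP)). Qed.

Section SmallPerturbation.
Variable g : solenoid R -> M.
Hypotheses (Wg : W g) (g1 : N (g - 1) < 2^-1).
Let w := g - 1.
Let z := minus_factor w.

Lemma sub1_in : W w. Proof. exact: (wiener_mxB nuP Wg (wiener_mx1 nuP)). Qed.

Lemma sub1_lt1 : N w < 1.
Proof. by apply: lt_trans g1 _; rewrite invf_lt1 ?ltr1n. Qed.

Lemma minus_factorP : W z /\ z + cut negative (z * w) = 1.
Proof. exact: (resolventP (wiener_mx_banach nuP) Toeplitz_bil sub1_in sub1_lt1 (wiener_mx1 nuP)). Qed.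

Lemma minus_factorM_in : W (z * w).
Proof. exact: (bilE (bil_mulr nuP) sub1_in minus_factorP.1). Qed.

Lemma minus_factorE : z = 1 + - cut negative (z * w).
Proof. by rewrite -[X in X + _]minus_factorP.2 addrK. Qed.

Lemma plus_factorE : z * g = 1 + cut nonneg (z * w).
Proof.
have -> : z * g = z + z * w by rewrite /w mulrBr mulr1 addrC subrK.
by rewrite [X in _ + X = _](cut_split nuP minus_factorM_in) addrA minus_factorP.2.
Qed.

(** Since z - 1 = - P-(z w), one has |z - 1| <= |z w| <= |w| + |z - 1| |w|. The
    bound 1/2 on |w| is exactly what makes |z w| smaller than 1. *)
Lemma minus_factorM_lt1 : N (z * w) < 1.
Proof.
have [Wz _] := minus_factorP.
have Wban := wiener_mx_banach nuP.
have Wone := wiener_mx1 nuP.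
have Wx : W (z - 1) by exact: (wiener_mxB nuP Wz Wone).
have Wc := wiener_mx_cut nuP negative minus_factorM_in.
have hx : N (z - 1) <= N (z * w).
  have -> : z - 1 = - cut negative (z * w) by rewrite {1}minus_factorE addrC addKr.
  by rewrite (subsp_normN Wban Wc) (cut_norm nuP _ minus_factorM_in).
have hzw : N (z * w) <= N w + N (z - 1) * N w.
  rewrite -{1}[z](subrK 1) mulrDl mul1r addrC.
  have [Wxw xw] := wiener_mxM nuP Wx sub1_in.
  by rewrite (le_trans (subsp_normD Wban sub1_in Wxw))// lerD2l.
have t0 := subsp_norm_ge0 Wban minus_factorM_in; have w0 := subsp_norm_ge0 Wban sub1_in.
have : N (z - 1) * N w <= N (z * w) * 2^-1.
  by apply: ler_pM => //; [exact: (subsp_norm_ge0 Wban)|exact: ltW].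
move: g1 hzw; rewrite -/w; lra.
Qed.

Lemma factorization_exists : normalized_factorization nu g z (z * g).
Proof.
have [Wz _] := minus_factorP; have Wban := wiener_mx_banach nuP; have Wone := wiener_mx1 nuP.
have Wc := wiener_mx_cut nuP negative minus_factorM_in.
have ez : z - 1 = - cut negative (z * w) by rewrite {1}minus_factorE addrC addKr.
have Lz : LambdaW z.
  apply: (LambdaW_near1 nuP) => //; rewrite ez (subsp_normN Wban)//.
  by rewrite (le_lt_trans (cut_norm nuP _ minus_factorM_in))// minus_factorM_lt1.
split=> //.
- apply/(wiener_minus0P nuP); rewrite ez; split; first exact: (wiener_mxN nuP Wc).
  by move=> q q0; rewrite (wiener_coefN nuP q Wc) (wiener_coef_cut nuP negative q minus_factorM_in) /negative ltNge q0 oppr0.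
- rewrite plus_factorE; apply: (Wplus_unit nuP); first exact: (Wplus_cut nuP minus_factorM_in).
  by rewrite (le_lt_trans (cut_norm nuP _ minus_factorM_in))// minus_factorM_lt1.
- apply/funext => u; have [_ [y _ [zy _]]] := Lz.
  have zyu : z u *m y u = 1%:M by have := congr1 (fun f => f u) zy.
  have [uz _] := mulmx1_unit zyu.
  by rewrite -[(z * g) u]/(z u *m g u) mulKmx.
Qed.

(** The conditions on the two factors say that [hm - 1] is strictly negative and
    that [hm * g] has no negative frequency. Read off coefficient by coefficient,
    they make [hm] a solution of the linear equation that defines [z]. *)
Lemma factorization_unique hm hp : normalized_factorization nu g hm hp ->
  hm = z /\ hp = z * g.
Proof.
case=> /(wiener_minus0P nuP)[Wx x0] [Wh [y _ [hy _]]] [/WplusP[Wp p0] _] eg.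
rewrite wiener_mxE in Wh.
have hg : hm * g = hp.
  apply/funext => u; rewrite -[LHS]/(hm u *m g u) eg.
  have hyu : hm u *m y u = 1%:M by have := congr1 (fun f => f u) hy.
  by have [uh _] := mulmx1_unit hyu; rewrite mulKVmx.
suff ehm : hm = z by split=> //; rewrite -hg ehm.
apply/esym; rewrite /z /minus_factor.
apply: (resolventE (wiener_mx_banach nuP) Toeplitz_bil sub1_in sub1_lt1 Wh); rewrite /Toeplitz.
have Whw : W (hm * w) := bilE (bil_mulr nuP) sub1_in Wh.
have Wc := wiener_mx_cut nuP negative Whw.
apply: (wiener_coef_inj nuP (wiener_mxD nuP Wh Wc) (wiener_mx1 nuP)) => q.
rewrite (wiener_coefD nuP q Wh Wc) (wiener_coef_cut nuP negative q Whw) /negative.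
have ehw : hm * w = hp - hm by rewrite /w mulrBr mulr1 hg.
rewrite ehw (wiener_coefB nuP q Wp Wh) (wiener_coef1 nuP).
case: ltP => q0; first by rewrite p0// sub0r subrr /unit_coef lt_eqF.
rewrite addr0 -[hm](subrK 1) (wiener_coefD nuP q Wx (wiener_mx1 nuP)) (wiener_coef1 nuP).
by rewrite x0// add0r.
Qed.

End SmallPerturbation.

(** Both factors have this shape: [L w z] is - P-(z w) for the minus factor and
    P+(z w) for the plus factor. *)
Definition factor_map (L : (solenoid R -> M) -> (solenoid R -> M) -> solenoid R -> M)
    (g : solenoid R -> M) : solenoid R -> M :=
  1 + L (g - 1) (minus_factor (g - 1)).

Lemma factor_map_analytic L g : contractive_bilinear W N L -> W g -> N (g - 1) < 1 ->
  analytic_at W N (factor_map L) g.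
Proof.
move=> HL Wg g1.
apply: (@analytic_at_shift _ _ _ _ (fun w => 1 + L w (minus_factor w))).
exact: (resolvent_analytic (wiener_mx_banach nuP) Toeplitz_bil HL (wiener_mx1 nuP) (wiener_mx1 nuP)
  (wiener_mxB nuP Wg (wiener_mx1 nuP)) g1).
Qed.

End Factorization.

Theorem theorem7 (R : realType) (n : nat) (nu : 'M[R[i]]_n -> R) :
  (0 < n)%N -> submult_norm nu ->
  exists2 eps : R, 0 < eps &
    (forall g : solenoid R -> 'M[R[i]]_n,
       LambdaW g -> wnorm nu (g - 1) < eps ->
       exists! h : (solenoid R -> 'M[R[i]]_n) * (solenoid R -> 'M[R[i]]_n),
         normalized_factorization nu g h.1 h.2) /\
    exists (delta : R)
           (Hm Hp : (solenoid R -> 'M[R[i]]_n) -> (solenoid R -> 'M[R[i]]_n)),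
      [/\ 0 < delta <= eps,
          forall g, mx_over (@wiener R) g -> wnorm nu (g - 1) < delta ->
            LambdaW g /\ normalized_factorization nu g (Hm g) (Hp g),
          forall g, mx_over (@wiener R) g -> wnorm nu (g - 1) < delta ->
            analytic_at (mx_over (@wiener R)) (wnorm nu) Hm g &
          forall g, mx_over (@wiener R) g -> wnorm nu (g - 1) < delta ->
            analytic_at (mx_over (@wiener R)) (wnorm nu) Hp g].
Proof.
move=> _ nuP; rewrite (wiener_normE nu) wiener_mxE.
have half0 : 0 < 2^-1 :> R by rewrite invr_gt0.
have half1 : 2^-1 < 1 :> R by rewrite invf_lt1 ?ltr1n.
exists 2^-1 => //; split.
  move=> g [Wg _] g1; rewrite wiener_mxE in Wg.
  exists (minus_factor (g - 1), minus_factor (g - 1) * g); split=> /=.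
    exact: factorization_exists.
  by case=> hm hp /= /(factorization_unique nuP Wg g1)[-> ->].
exists 2^-1, (factor_map (fun w y => - Toeplitz w y)),
  (factor_map (fun w y => cut nonneg (y * w))).
split.
- by rewrite half0 lexx.
- move=> g Wg g1; rewrite /factor_map /Toeplitz -(minus_factorE nuP Wg g1) -(plus_factorE nuP Wg g1).
  split; first by apply: (LambdaW_near1 nuP) => //; exact: lt_trans g1 half1.
  exact: factorization_exists.
- move=> g Wg g1; apply: (factor_map_analytic nuP _ Wg (lt_trans g1 half1)).
  exact: (bil_opp nuP (Toeplitz_bil nuP)).
- move=> g Wg g1; apply: (factor_map_analytic nuP _ Wg (lt_trans g1 half1)).
  exact: (bil_cut nuP nonneg (bil_mulr nuP)).
Qed.
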